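(* Let $A\in\mathbb{R}^{m\times n}$ be an integer (or rational) matrix with $\operatorname{rank}(A)=m$ and let $L$ be the bit size of $A$. The time complexity of the primal algorithm (the Main Algorithm for the Primal Problem, which calls the Basic Procedure for the Primal Problem, both defined in the context) on input $A$ is $O(n^4mL)$.
   Context: Time is counted in arithmetic operations; the step-size $c\in(0,2)$ is a fixed constant. Vector inequalities are coordinatewise, $\mathbf 1$ is the all-ones vector, $e_k$ the $k$th unit vector, $x^+=\max\{0,x\}$ coordinatewise. $(\cdot)^\dagger$ is the Moore-Penrose pseudoinverse. The primal algorithm addresses the feasibility problem: find $x$ with $Ax=0$, $x\ge 0$, $x\ne 0$, equivalently (by homogeneity) $Ax=0$, $x\in[0,1]^n$, $x\neq 0$. The dual problem is: find $u\in\mathbb{R}^m$ with $A^Tu>0$. For a matrix $A$, $Q_A=A^T(AA^T)^\dagger A$ and $P_A=I-Q_A$ (orthogonal projections onto the row space and null space). For a vector $y$ put $v=Q_Ay$ and, for each $j$ with $v_j\ne 0$, $\mathrm{bound}_j(y)=\mathbf 1^T\big[\frac{v}{-v_j}\big]^+$. Basic Procedure for the Primal Problem. Input: $Q_A$, of size $r\times r$, where $A$ is the current matrix with $r\le n$ columns ($n$ is the number of columns of the original matrix). Set $\mathrm{threshold}=\frac{1}{2r^{3/2}}$, $y=\mathbf 1/r$, $v=Q_Ay$; throughout $z=y-v=P_Ay$. Repeat the following iteration: (1) if $z>0$, return with case $=1$ ($z$ is primal feasible); (2) else if $v>0$ and $r=n$, return with case $=2$ ($v$ is dual feasible); (3)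 else let $K=\{k: v_k\le 0\}$, $q_K=Q_A\sum_{k\in K}e_k$, $\alpha=\langle \frac{q_K}{\|q_K\|_2},v\rangle$ (with $\alpha:=0$ if $q_K=0$). If $\alpha\le-\mathrm{threshold}$, replace $y$ by $y-c\frac{\alpha}{\|q_K\|_2}\sum_{k\in K}e_k$ and $v$ by $v-c\frac{\alpha}{\|q_K\|_2}q_K$. Otherwise return with case $=0$ and a nonempty set $J\subseteq\{j:\mathrm{bound}_j(y)\le \frac12\}$. Main Algorithm for the Primal Problem. Start with $d=\mathbf 1\in\mathbb{R}^n$, $\tau=2^{-L}$, case $=0$, $H=\varnothing$. Columns of the current matrix keep their original indices in $\{1,\dots,n\}$. While case $=0$: compute $Q_A=A^T(AA^T)^\dagger A$; run the Basic Procedure on $Q_A$ to get $(y,z,J,\text{case})$; if case $=0$, set $d_J=d_J/2$, $H=\{i:d_i\le\tau\}$, $d_H=0$, divide the columns of $A$ indexed by $J$ by $2$, and then delete from $A$ all columns indexed by $H$ (so $A=A_{\overline H}$). When the loop ends with case $=1$, set $D=\mathrm{diag}(d_{\overline H})$ and output $x$ with $x_{\overline H}=Dz$, $x_H=0$. (If no column remains, i.e. $r=0$, the test $z>0$ is regarded as satisfied.) *)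

(* Defs.v *)
From mathcomp Require Import all_boot all_order all_algebra.
From mathcomp Require Import reals.
Set Implicit Arguments.
Unset Strict Implicit.
Unset Printing Implicit Defensive.
Import Order.TTheory GRing.Theory Num.Theory.
Local Open Scope ring_scope.

Definition dot (R : realType) r (x y : 'cV[R]_r) : R :=
  \sum_i x i 0 * y i 0.

(* The norm that the libraries put on matrices is the sup norm. *)
Definition norm2 (R : realType) r (x : 'cV[R]_r) : R :=
  Num.sqrt (\sum_i x i 0 ^+ 2).

(* The four Penrose equations; MathComp's [pinvmx] is only a partial inverse. *)
Definition is_MPinverse (R : realType) p q (M : 'M[R]_(p, q))
    (X : 'M[R]_(q, p)) : Prop :=
  [/\ M *m X *m M = M, X *m M *m X = X,
      (M *m X)^T = M *m X & (X *m M)^T = X *m M].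

(* Q = A^T (A A^T)^dagger A *)
Definition is_Q (R : realType) m r (A : 'M[R]_(m, r)) (Q : 'M[R]_r) : Prop :=
  exists2 G, is_MPinverse (A *m A^T) G & Q = A^T *m G *m A.

Definition pos_vec (R : realType) r (x : 'cV[R]_r) : bool :=
  [forall j, 0 < x j 0].

(* [up_log 2 k.+1] is the ceiling of log_2 (k + 1); the leading 1 is the sign
   bit.  A rational entry is the pair of its reduced numerator and
   denominator. *)
Definition int_bits (z : int) : nat := (1 + up_log 2 `|z|%N.+1)%N.

Definition rat_bits (q : rat) : nat :=
  (int_bits (numq q) + up_log 2 `|denq q|%N.+1)%N.

Inductive has_bit_size (R : realType) m n (A : 'M[R]_(m, n)) : nat -> Prop :=
| IntBitSize (A0 : 'M[int]_(m, n)) of A = map_mx intr A0 :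
    has_bit_size A (\sum_i \sum_j int_bits (A0 i j))
| RatBitSize (A0 : 'M[rat]_(m, n)) of A = map_mx ratr A0 :
    has_bit_size A (\sum_i \sum_j rat_bits (A0 i j)).

(* [V] is [R] in the algorithm and [nat] (memory addresses) in its
   implementations. *)
Record iterate (V : Type) r := Iterate {
  it_y : 'cV[V]_r;
  it_v : 'cV[V]_r;
  it_z : 'cV[V]_r
}.

Variant bp_case r :=
| Case1
| Case2
| Case0 of {set 'I_r}.

Definition threshold (R : realType) r : R :=
  (2 * Num.sqrt (r%:R ^+ 3))^-1.

Definition bound (R : realType) r (Q : 'M[R]_r) (y : 'cV[R]_r) (j : 'I_r) : R :=
  let v := Q *m y in \sum_i Num.max 0 (v i 0 / - v j 0).

Definition small_bound (R : realType) r (Q : 'M[R]_r) (y : 'cV[R]_r) :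
    {set 'I_r} :=
  [set j | ((Q *m y) j 0 != 0) && (bound Q y j <= 1 / 2)].

Definition e_K (R : realType) r (v : 'cV[R]_r) : 'cV[R]_r :=
  \sum_(k | v k 0 <= 0) delta_mx k 0.

Definition q_K (R : realType) r (Q : 'M[R]_r) (v : 'cV[R]_r) : 'cV[R]_r :=
  Q *m e_K v.

Definition alpha (R : realType) r (Q : 'M[R]_r) (v : 'cV[R]_r) : R :=
  let q := q_K Q v in
  if q == 0 then 0 else dot ((norm2 q)^-1 *: q) v.

Definition current_iterate (R : realType) r (y v : 'cV[R]_r) : iterate R r :=
  Iterate y v (y - v).

(* [bp_run c full Q y v its ret case]: the loop entered with (y, v) may go
   through the iterates [its] and return at the iterate [ret] with [case];
   [full] stands for the condition r = n.  The choice of J is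
   nondeterministic. *)
Inductive bp_run (R : realType) (c : R) (full : bool) r (Q : 'M[R]_r) :
    'cV[R]_r -> 'cV[R]_r -> seq (iterate R r) -> iterate R r -> bp_case r ->
    Prop :=
| BpPrimal y v of
    pos_vec (y - v) :
    bp_run c full Q y v [::] (current_iterate y v) (Case1 r)
| BpDual y v of
    ~~ pos_vec (y - v) & pos_vec v && full :
    bp_run c full Q y v [::] (current_iterate y v) (Case2 r)
| BpStep y v its ret case of
    ~~ pos_vec (y - v) & ~~ (pos_vec v && full) &
    alpha Q v <= - threshold R r &
    bp_run c full Q
      (y - (c * (alpha Q v / norm2 (q_K Q v))) *: e_K v)
      (v - (c * (alpha Q v / norm2 (q_K Q v))) *: q_K Q v)
      its ret case :
    bp_run c full Q y v (current_iterate y v :: its) ret case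
| BpCut y v (J : {set 'I_r}) of
    ~~ pos_vec (y - v) & ~~ (pos_vec v && full) &
    - threshold R r < alpha Q v &
    J != set0 & J \subset small_bound Q y :
    bp_run c full Q y v [::] (current_iterate y v) (Case0 J).

Definition basic_procedure (R : realType) (c : R) (full : bool) r
    (Q : 'M[R]_r) : seq (iterate R r) -> iterate R r -> bp_case r -> Prop :=
  let y := const_mx (r%:R^-1) in bp_run c full Q y (Q *m y).

(* Deleted columns stay in [ms_B] as dead storage; the algorithm only sees
   [current st], the submatrix of the columns outside [ms_H]. *)
Record mstate (V : Type) m n := MState {
  ms_d : 'cV[V]_n;
  ms_B : 'M[V]_(m, n);
  ms_H : {set 'I_n}
}.

Definition ncols (V : Type) m n (st : mstate V m n) : nat := #|~: ms_H st|.

(* The original index of a column of the current matrix. *)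
Definition orig (V : Type) m n (st : mstate V m n) (j : 'I_(ncols st)) : 'I_n :=
  enum_val j.

Definition current (V : Type) m n (st : mstate V m n) : 'M[V]_(m, ncols st) :=
  colsub (@orig V m n st) (ms_B st).

Definition orig_set (V : Type) m n (st : mstate V m n)
    (J : {set 'I_(ncols st)}) : {set 'I_n} :=
  [set orig j | j in J].

Definition init_state (R : realType) m n (A : 'M[R]_(m, n)) : mstate R m n :=
  MState (const_mx 1) A set0.

Definition rescale (R : realType) (tau : R) m n (st : mstate R m n)
    (J : {set 'I_(ncols st)}) : mstate R m n :=
  let J' := orig_set J in
  let d1 : 'cV[R]_n :=
    \col_i (if i \in J' then ms_d st i 0 / 2 else ms_d st i 0) in
  let H := [set i | d1 i 0 <= tau] in
  MState (\col_i (if i \in H then 0 else d1 i 0))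
         (\matrix_(i, j) (if j \in J' then ms_B st i j / 2 else ms_B st i j))
         H.

(* x_j = d_j z_j on the remaining columns, x_H = 0 *)
Definition output_vec (R : realType) m n (st : mstate R m n)
    (z : 'cV[R]_(ncols st)) : 'cV[R]_n :=
  \col_i (if [pick j | orig j == i] is Some j then ms_d st i 0 * z j 0 else 0).

(* One pass through the main loop: the state on entry, Q, the iterates of the
   call of the Basic Procedure, and what that call returns. *)
Record round (V : Type) m n := Round {
  rd_st : mstate V m n;
  rd_Q : 'M[V]_(ncols rd_st);
  rd_its : seq (iterate V (ncols rd_st));
  rd_ret : iterate V (ncols rd_st);
  rd_case : bp_case (ncols rd_st)
}.

(* [tr_out] is [Some x] when the loop ends with case = 1, [None] when it ends
   with case = 2. *)
Record trace (V : Type) m n := Trace {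
  tr_rounds : seq (round V m n);
  tr_out : option 'cV[V]_n
}.

(* A rule resolving the free choice of J: in the k-th round with case = 0, the
   set J chosen among the candidates {j : bound_j <= 1/2} (original indices).
   Every run of the algorithm on a given input follows some such rule. *)
Definition selector n := nat -> {set 'I_n} -> {set 'I_n}.

Definition valid_selector n (sel : selector n) : Prop :=
  forall k S, S != set0 -> (sel k S != set0) && (sel k S \subset S).

Inductive main_run (R : realType) (c tau : R) m n (sel : selector n) :
    nat -> mstate R m n -> seq (round R m n) -> option 'cV[R]_n -> Prop :=
| MainPrimal k st Q its ret of
    is_Q (current st) Q &
    basic_procedure c (ncols st == n) Q its ret (Case1 _) :
    main_run c tau sel k st
      [:: @Round R m n st Q its ret (Case1 _)]
      (Some (output_vec (it_z ret)))
| MainDual k st Q its ret of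
    is_Q (current st) Q &
    basic_procedure c (ncols st == n) Q its ret (Case2 _) :
    main_run c tau sel k st
      [:: @Round R m n st Q its ret (Case2 _)]
      None
| MainRescale k st Q its ret (J : {set 'I_(ncols st)}) rounds out of
    is_Q (current st) Q &
    basic_procedure c (ncols st == n) Q its ret (Case0 J) &
    orig_set J = sel k (orig_set (small_bound Q (it_y ret))) &
    main_run c tau sel k.+1 (rescale tau J) rounds out :
    main_run c tau sel k st
      (@Round R m n st Q its ret (Case0 J) :: rounds)
      out.

Definition main_algorithm (R : realType) (c : R) m n (L : nat)
    (sel : selector n) (A : 'M[R]_(m, n)) (tr : trace R m n) : Prop :=
  main_run c (2 ^- L) sel 0 (init_state A) (tr_rounds tr) (tr_out tr).

(* Algebraic computation trees: real numbers live in a write-once memory and a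
   program manipulates them only through their addresses, so that it depends
   on the data only via the outcomes of the tests [<=].  [Arith o i j k] stores
   the result in a fresh cell, whose address is passed to [k]. *)
Variant arith := Add | Sub | Mul | Div.

Inductive prog (X : Type) :=
| Ret of X
| Arith of arith & nat & nat & (nat -> prog X)
| Leq of nat & nat & (bool -> prog X).

Definition eval_arith (R : realType) (o : arith) (x y : R) : R :=
  match o with
  | Add => x + y
  | Sub => x - y
  | Mul => x * y
  | Div => x / y
  end.

(* Final memory, returned value, and number of operations (arithmetic operations
   and comparisons) executed. *)
Fixpoint exec (R : realType) (X : Type) (mem : seq R) (p : prog X) :
    seq R * X * nat :=
  match p with
  | Ret x => (mem, x, 0%N)
  | Arith o i j k =>
      let: (mem', x, t) :=
        exec (rcons mem (eval_arith o mem`_i mem`_j)) (k (size mem)) in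
      (mem', x, t.+1)
  | Leq i j k =>
      let: (mem', x, t) := exec mem (k (mem`_i <= mem`_j)) in
      (mem', x, t.+1)
  end.

Definition input (R : realType) (c : R) m n (A : 'M[R]_(m, n)) : seq R :=
  [:: 1, c & [seq A i j | i <- enum 'I_m, j <- enum 'I_n]].

(* Reading a trace of addresses in memory. *)
Definition map_iterate (V W : Type) (f : V -> W) r (it : iterate V r) :
    iterate W r :=
  Iterate (map_mx f (it_y it)) (map_mx f (it_v it)) (map_mx f (it_z it)).

Definition map_mstate (V W : Type) (f : V -> W) m n (st : mstate V m n) :
    mstate W m n :=
  MState (map_mx f (ms_d st)) (map_mx f (ms_B st)) (ms_H st).

Definition map_round (V W : Type) (f : V -> W) m n (rd : round V m n) :
    round W m n :=
  @Round W m n (map_mstate f (rd_st rd))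
    (map_mx f (rd_Q rd))
    (map (@map_iterate V W f _) (rd_its rd))
    (map_iterate f (rd_ret rd))
    (rd_case rd).

Definition map_trace (V W : Type) (f : V -> W) m n (tr : trace V m n) :
    trace W m n :=
  Trace (map (@map_round V W f m n) (tr_rounds tr))
    (omap (map_mx f) (tr_out tr)).

(* Executed on A, the program computes the whole run of the Main Algorithm that
   follows [sel], in at most [T] operations. *)
Definition carries_out (R : realType) (c : R) m n (L : nat) (sel : selector n)
    (A : 'M[R]_(m, n)) (p : prog (trace nat m n)) (T : nat) : Prop :=
  let: (mem, tr, t) := exec (input c A) p in
  main_algorithm c L sel A (map_trace (fun i => mem`_i) tr) /\ (t <= T)%N.

(* Main.v *)
Require Import Defs.
From mathcomp Require Import all_boot all_order all_algebra.
From mathcomp Require Import reals.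
From mathcomp Require Import zify ring.
Import Order.TTheory GRing.Theory Num.Theory.
Local Open Scope ring_scope.

Set Implicit Arguments.
Unset Strict Implicit.
Unset Printing Implicit Defensive.

(* The projection Q is applied through an orthogonal basis of the row space of
   the current matrix, computed by Gram-Schmidt, which costs O(mn) per vector.
   A step of the Basic Procedure lowers |v|^2 by c(2-c) alpha^2, which is at
   least c(2-c)/(4r^3), and initially |v|^2 <= 1/r, so a call makes O(n^2)
   steps and costs O(n^3 m).  A call that refuses a step has a nonempty set of
   candidates J, because the negative part of v has 1-norm at most 1/(2r) while
   v_j >= y_j >= 1/r for some j.  Each call with case 0 halves some d_j, which
   is halved at most L times, so there are at most nL + 1 calls. *)

(** * Orthogonal projection by Gram-Schmidt *)

(** The cost of one projection decides the exponent. A product with the stored matrix [Q] would take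
    r^2 operations, hence n^4 per call and n^5 L in all; the basis has m vectors, and rank(A) = m
    gives m <= n, so a factor n is replaced by m. The pseudoinverse itself is never computed. A
    matrix of the form A^T M A that fixes the rows of A has to be Q_A, and the projector built from
    the basis has both properties. Square roots are not among the operations of a program. The basis
    vectors therefore stay unnormalized, the test on alpha is squared, and in the step length the
    two norms in the denominator combine to a dot product. A program is a well-founded tree, so both
    loops recurse on fuel and return a meaningless value when it runs out. That branch is excluded
    by two potentials kept below the fuel: 4 r^3 |v|^2, measured in units of c(2-c), for the inner
    loop and the number of halvings left for the outer one. *)

Section Dot.
Variables (R : realType) (r : nat).
Implicit Types (x y : 'cV[R]_r) (Q : 'M[R]_r).

Lemma dotE x y : dot x y = (x^T *m y) 0 0.
Proof. by rewrite mxE; apply: eq_bigr => i _; rewrite mxE. Qed.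

Lemma dotC x y : dot x y = dot y x.
Proof. by apply: eq_bigr => i _; rewrite mulrC. Qed.

Lemma dot0l y : dot 0 y = 0.
Proof. by rewrite dotE trmx0 mul0mx mxE. Qed.

Lemma dotDl x x' y : dot (x + x') y = dot x y + dot x' y.
Proof. by rewrite !dotE linearD mulmxDl mxE. Qed.

Lemma dotZl a x y : dot (a *: x) y = a * dot x y.
Proof. by rewrite !dotE linearZ -scalemxAl mxE. Qed.

Lemma dotBl x x' y : dot (x - x') y = dot x y - dot x' y.
Proof. by rewrite dotDl -scaleN1r dotZl mulN1r. Qed.

Lemma dotBr x y y' : dot x (y - y') = dot x y - dot x y'.
Proof. by rewrite dotC dotBl !(dotC x). Qed.

Lemma dotZr a x y : dot x (a *: y) = a * dot x y.
Proof. by rewrite dotC dotZl dotC. Qed.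

Lemma dot_suml (I : Type) (s : seq I) (F : I -> 'cV[R]_r) y :
  dot (\sum_(i <- s) F i) y = \sum_(i <- s) dot (F i) y.
Proof.
by elim: s => [|i s IH]; rewrite ?big_nil ?dot0l// !big_cons dotDl IH.
Qed.

Lemma dot_mulmxl Q x y : dot (Q *m x) y = dot x (Q^T *m y).
Proof. by rewrite !dotE trmx_mul mulmxA. Qed.

Lemma dot_ge0 x : 0 <= dot x x.
Proof. by apply: sumr_ge0 => i _; rewrite -expr2 sqr_ge0. Qed.

Lemma dot_eq0 x : (dot x x == 0) = (x == 0).
Proof.
apply/idP/eqP => [|->]; last by rewrite dot0l.
rewrite psumr_eq0 => [/allP x0|i _]; last by rewrite -expr2 sqr_ge0.
apply/colP => i; have := x0 i (mem_index_enum _).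
by rewrite /= mulf_eq0 orbb mxE => /eqP.
Qed.

Lemma dot_gt0 x : x != 0 -> 0 < dot x x.
Proof. by rewrite lt0r dot_ge0 andbT dot_eq0. Qed.

Lemma sqr_norm2 x : norm2 x ^+ 2 = dot x x.
Proof.
rewrite sqr_sqrtr; last by apply: sumr_ge0 => i _; rewrite sqr_ge0.
by apply: eq_bigr => i _; rewrite expr2.
Qed.

Lemma norm2_gt0 x : x != 0 -> 0 < norm2 x.
Proof.
move=> x0; rewrite lt0r sqrtr_ge0 andbT -sqrf_eq0 sqr_norm2 dot_eq0 x0 //.
Qed.

End Dot.

(** * Gram matrices, pseudoinverses and a characterization of Q_A *)

Lemma mulmx_tr_eq0 (R : realType) p q (X : 'M[R]_(p, q)) :
  X *m X^T = 0 -> X = 0.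
Proof.
move=> X0; apply/row_matrixP => i; rewrite row0 -[row i X]trmxK -[RHS]trmxK.
congr trmx; rewrite trmx0; apply/eqP; rewrite -dot_eq0; apply/eqP.
have /matrixP/(_ i i) := X0; rewrite !mxE => <-.
by apply: eq_bigr => j _; rewrite !mxE.
Qed.

(** If K X X^T = 0 then (K X)(K X)^T = 0, so K X = 0, and K = 0 because X is row free. *)
Lemma gram_unitmx (R : realType) p q (X : 'M[R]_(p, q)) :
  row_free X -> X *m X^T \in unitmx.
Proof.
move=> Xfree; rewrite -row_free_unit -kermx_eq0; apply/eqP.
apply: (row_free_inj Xfree); rewrite mul0mx; apply: mulmx_tr_eq0.
by rewrite trmx_mul mulmxA -[_ *m X *m X^T]mulmxA mulmx_ker mul0mx.
Qed.

(* Full-rank factorization S = C B gives B^T (B B^T)^-1 (C^T C)^-1 C^T. *)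
Lemma MPinverse_exists (R : realType) p q (S : 'M[R]_(p, q)) :
  exists G, is_MPinverse S G.
Proof.
have := mulmx_base S; have := row_base_free S.
have : row_free (col_base S)^T.
  by rewrite /row_free mxrank_tr; exact: col_base_full.
move: (\rank S) (col_base S) (row_base S) => k0 C B Cfree Bfree /esym SE.
have BBu : B *m B^T \in unitmx by exact: gram_unitmx.
have CCu : C^T *m C \in unitmx by rewrite -{2}[C]trmxK gram_unitmx.
pose IB := invmx (B *m B^T); pose IC := invmx (C^T *m C).
have BK k (Z : 'M_(_, k)) : B *m (B^T *m (IB *m Z)) = Z.
  by rewrite !mulmxA mulmxV ?mul1mx.
have CK k (Z : 'M_(_, k)) : IC *m (C^T *m (C *m Z)) = Z.
  by rewrite !mulmxA -[IC *m C^T *m C]mulmxA mulVmx ?mul1mx.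
have BK' k (Z : 'M_(_, k)) : IB *m (B *m (B^T *m Z)) = Z.
  by rewrite !mulmxA -[IB *m B *m _]mulmxA mulVmx ?mul1mx.
have CK' k (Z : 'M_(_, k)) : C^T *m (C *m (IC *m Z)) = Z.
  by rewrite !mulmxA mulmxV ?mul1mx.
have IBT : IB^T = IB by rewrite trmx_inv trmx_mul trmxK.
have ICT : IC^T = IC by rewrite trmx_inv trmx_mul trmxK.
exists (B^T *m IB *m IC *m C^T).
rewrite SE; split; rewrite ?trmx_mul ?trmxK ?IBT ?ICT -!mulmxA ?BK ?CK //.
  by rewrite BK'.
by rewrite CK'.
Qed.

(** This replaces the pseudoinverse by two checkable properties. For G the pseudoinverse of A A^T,
    the equation A = A Q gives A^T G A = (A^T G A A^T) M A, and the bracket is A^T. *)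
Lemma is_Q_of_fixed (R : realType) m r (A : 'M[R]_(m, r)) (M : 'M[R]_m) Q :
  Q = A^T *m M *m A -> A *m Q = A -> is_Q A Q.
Proof.
move=> QE AQ; have [G GP] := MPinverse_exists (A *m A^T).
exists G => //; case: GP => SGS _ _ _.
(* Put S = A A^T and X = G S - 1. The Penrose equation S G S = S gives S X = 0, so (A^T X)^T (A^T X)
   = X^T S X = 0 and A^T X = 0. *)
have AGS : A^T *m (G *m (A *m A^T)) = A^T.
  apply/eqP; rewrite -subr_eq0 -[X in _ - X]mulmx1 -mulmxBr; apply/eqP.
  set X := (X in _ *m X); rewrite -[_ *m X]trmxK; apply/(canLR trmxK).
  rewrite trmx0; apply: mulmx_tr_eq0; rewrite trmxK trmx_mul trmxK.
  rewrite -mulmxA [A *m _]mulmxA /X mulmxBr mulmx1.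
  by rewrite [_ *m (G *m _)]mulmxA SGS subrr mulmx0.
rewrite -{2}AQ QE !mulmxA -[A^T *m G *m A *m A^T]mulmxA.
by rewrite -[A^T *m G *m _]mulmxA AGS.
Qed.

Section GramSchmidt.
Variables (R : realType) (r : nat).
Implicit Types (x a w : 'cV[R]_r) (ws s : seq 'cV[R]_r).

(* For w = 0 the coefficient is x / 0 = 0, so null vectors need no test. *)
Definition proj ws x : 'cV[R]_r :=
  \sum_(w <- ws) (dot x w / dot w w) *: w.

Definition projmx ws : 'M[R]_r :=
  \sum_(w <- ws) (dot w w)^-1 *: (w *m w^T).

(** Normalizing would take square roots, so the vectors keep their lengths and [proj] divides by
    [dot w w]. A row that depends on the earlier ones leaves a null vector. *)
Definition gram_schmidt s :=
  foldl (fun ws a => rcons ws (a - proj ws a)) [::] s.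

Definition orthogonal_seq ws := pairwise (fun u w => dot u w == 0) ws.

Lemma projmxE ws x : projmx ws *m x = proj ws x.
Proof.
rewrite /projmx mulmx_suml; apply: eq_bigr => w _.
rewrite -scalemxAl -mulmxA [w^T *m x]mx11_scalar -dotE mul_mx_scalar scalerA.
by rewrite mulrC dotC.
Qed.

Lemma dot_proj ws x w : orthogonal_seq ws -> w \in ws ->
  dot (proj ws x) w = dot x w.
Proof.
rewrite /proj; elim: ws => //= u ws IH /andP[/allP uws ows].
rewrite big_cons dotDl inE => /orP[/eqP ->|wws].
  rewrite dot_suml big_seq big1 ?addr0 => [|v vws].
    rewrite dotZl; have [->|u0] := eqVneq u 0.
      by rewrite dotC !dot0l mul0r mulr0.
    by rewrite divfK // dot_eq0.
  by rewrite dotZl (dotC v u) (eqP (uws _ vws)) mulr0.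
by rewrite dotZl (eqP (uws _ wws)) mulr0 add0r IH.
Qed.

(** The residual w - proj w is orthogonal to every member of [ws], hence to w and to proj w, hence
    to itself. This argument also covers null vectors. *)
Lemma projmx_fix ws w : orthogonal_seq ws -> w \in ws -> projmx ws *m w = w.
Proof.
move=> ows wws; rewrite projmxE.
pose u := w - proj ws w.
have u_orth v : v \in ws -> dot u v = 0.
  by move=> vws; rewrite dotBl dot_proj ?subrr.
suff /eqP : u = 0 by rewrite subr_eq0 => /eqP.
apply/eqP; rewrite -dot_eq0 {2}/u dotBr u_orth // sub0r oppr_eq0.
rewrite dotC dot_suml big_seq big1 // => v vws.
by rewrite dotZl (dotC v u) u_orth // mulr0.
Qed.

Lemma projmx_tr ws : (projmx ws)^T = projmx ws.
Proof.
rewrite /projmx raddf_sum; apply: eq_bigr => w _.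
by rewrite /= linearZ /= trmx_mul trmxK.
Qed.

Lemma projmx_idem ws : orthogonal_seq ws ->
  projmx ws *m projmx ws = projmx ws.
Proof.
move=> ows; rewrite {2 3}/projmx mulmx_sumr big_seq [RHS]big_seq.
apply: eq_bigr => w wws.
by rewrite -scalemxAr mulmxA projmx_fix.
Qed.

Lemma gram_schmidt_rcons s a :
  gram_schmidt (rcons s a) =
  rcons (gram_schmidt s) (a - proj (gram_schmidt s) a).
Proof. by rewrite /gram_schmidt foldl_rcons. Qed.

Lemma size_gram_schmidt s : size (gram_schmidt s) = size s.
Proof.
by elim/last_ind: s => // s a IH; rewrite gram_schmidt_rcons !size_rcons IH.
Qed.

Lemma gram_schmidt_orthogonal s : orthogonal_seq (gram_schmidt s).
Proof.
elim/last_ind: s => // s a IH; rewrite gram_schmidt_rcons.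
rewrite /orthogonal_seq pairwise_rcons; apply/andP; split=> //.
by apply/allP => w ws; rewrite dotC dotBl dot_proj // subrr.
Qed.

(** Each row is its residual plus a combination of earlier basis vectors. Applied to the projector,
    this yields [A *m Q = A], one of the two conditions of [is_Q_of_fixed]. *)
Lemma gram_schmidt_fix (Q : 'M[R]_r) s :
  {in gram_schmidt s, forall w, Q *m w = w} -> {in s, forall a, Q *m a = a}.
Proof.
elim/last_ind: s => // s a IH; rewrite gram_schmidt_rcons => Qfix.
have Qs w : w \in gram_schmidt s -> Q *m w = w.
  by move=> wG; apply: Qfix; rewrite mem_rcons inE wG orbT.
move=> b; rewrite mem_rcons inE => /orP[/eqP->|]; last exact: IH.
have -> : a = (a - proj (gram_schmidt s) a) + proj (gram_schmidt s) a.
  by rewrite subrK.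
rewrite mulmxDr Qfix ?mem_rcons ?mem_head //; congr (_ + _).
rewrite mulmx_sumr big_seq [RHS]big_seq; apply: eq_bigr => w wG.
by rewrite -scalemxAr Qs.
Qed.

(** With B = A^T it yields the other condition: for w = A^T t the summand w w^T of the projector is
    A^T (t t^T) A. *)
Lemma gram_schmidt_span k (B : 'M[R]_(r, k)) s :
  {in s, forall a, exists t, a = B *m t} ->
  {in gram_schmidt s, forall w, exists t, w = B *m t}.
Proof.
elim/last_ind: s => // s a IH sB; rewrite gram_schmidt_rcons => w.
have {}IH v : v \in gram_schmidt s -> exists t, v = B *m t.
  by apply: IH => b bs; apply: sB; rewrite mem_rcons inE bs orbT.
rewrite mem_rcons inE => /orP[/eqP->|]; last exact: IH.
have [t ->] : exists t, a = B *m t by apply: sB; rewrite mem_rcons mem_head.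
have [u ->] : exists u, proj (gram_schmidt s) (B *m t) = B *m u.
  rewrite /proj big_seq.
  elim/big_ind: _ => [|x y [u ->] [v ->]|v /IH[u ->]].
  - by exists 0; rewrite mulmx0.
  - by exists (u + v); rewrite mulmxDr.
  - by eexists; rewrite scalemxAr.
by exists (t - u); rewrite mulmxBr.
Qed.

End GramSchmidt.

Definition rows_of (V : Type) m r (A : 'M[V]_(m, r)) : seq 'cV[V]_r :=
  [seq (row i A)^T | i <- enum 'I_m].

(** Deleting columns may make the remaining rows dependent; the null vectors that this produces
    contribute nothing to the projector. *)
Lemma gram_schmidt_is_Q (R : realType) m r (A : 'M[R]_(m, r)) :
  is_Q A (projmx (gram_schmidt (rows_of A))).
Proof.
set ws := gram_schmidt _.
have ows : orthogonal_seq ws by exact: gram_schmidt_orthogonal.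
have span : {in ws, forall w, exists t : 'cV_m, w = A^T *m t}.
  apply: gram_schmidt_span => a /mapP[i _ ->].
  by exists (delta_mx 0 i)^T; rewrite -trmx_mul -rowE.
have [M QE] : exists M, projmx ws = A^T *m M *m A.
  rewrite /projmx big_seq.
  elim/big_ind: _ => [|X Y [M ->] [N ->]|w /span[t ->]].
  - by exists 0; rewrite mulmx0 mul0mx.
  - by exists (M + N); rewrite mulmxDr mulmxDl.
  - eexists; rewrite trmx_mul trmxK -mulmxA [t *m _]mulmxA mulmxA.
    by rewrite scalemxAl scalemxAr.
apply: is_Q_of_fixed QE _; apply/row_matrixP => i; rewrite row_mul.
apply: trmx_inj; rewrite trmx_mul projmx_tr.
apply: (@gram_schmidt_fix _ _ _ (rows_of A)); last first.
  by apply/mapP; exists i; rewrite ?mem_enum.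
by move=> w; exact: projmx_fix.
Qed.

(** * Steps of the Basic Procedure *)

Section BasicProcedure.
Variables (R : realType) (r : nat) (Q : 'M[R]_r).
Hypotheses (Qsym : Q^T = Q) (Qidem : Q *m Q = Q).
Implicit Types (x y v : 'cV[R]_r).

Lemma e_KE v : e_K v = \col_i (if v i 0 <= 0 then 1 else 0).
Proof.
apply/colP => i; rewrite summxE mxE big_mkcond (bigD1 i) //= big1 => [|j ji].
  by rewrite addr0; case: ifP => // _; rewrite mxE !eqxx.
by case: ifP => // _; rewrite mxE eq_sym (negPf ji).
Qed.

Lemma dot_proj_self x : dot (Q *m x) (Q *m x) = dot (Q *m x) x.
Proof. by rewrite dotC dot_mulmxl Qsym mulmxA Qidem dotC. Qed.

Lemma dot_proj_le x : dot (Q *m x) (Q *m x) <= dot x x.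
Proof.
have := dot_ge0 (x - Q *m x); rewrite !dotBl !dotBr dot_proj_self.
by rewrite (dotC x (Q *m x)) subrr subr0 subr_ge0.
Qed.

Lemma dot_const (a : R) : dot (const_mx a : 'cV_r) (const_mx a) = r%:R * a ^+ 2.
Proof.
rewrite /dot (eq_bigr (fun=> a ^+ 2)) => [|i _]; last by rewrite !mxE expr2.
by rewrite sumr_const card_ord mulr_natl.
Qed.

(* The right-hand side needs no square root, so a program can test it. *)
Lemma step_testE v : (0 < r)%N ->
  (alpha Q v <= - threshold R r) =
  ~~ (0 <= dot (q_K Q v) v) &&
  (dot (q_K Q v) (q_K Q v) <= 4 * r%:R ^+ 3 * dot (q_K Q v) v ^+ 2).
Proof.
move=> r0; rewrite /alpha /threshold; set q := q_K Q v.
have R3 : 0 < r%:R ^+ 3 :> R by rewrite exprn_gt0 // ltr0n.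
have := sqr_sqrtr (ltW R3); set rho := Num.sqrt _ => rhoE.
have rho0 : 0 < rho by rewrite sqrtr_gt0.
have [->|q0] := eqVneq q 0.
  by rewrite !dot0l lexx leNgt oppr_lt0 invr_gt0 mulr_gt0.
have N0 := norm2_gt0 q0; rewrite dotZl -ltNge.
rewrite [_^-1 * _]mulrC ler_pdivrMr // mulNr mulrC lerNr.
rewrite ler_pdivrMr ?mulr_gt0 //.
set s := dot q v; have [s0|s0] := ltP s 0; last first.
  apply/negbTE; rewrite -ltNge (le_lt_trans _ N0) // mulNr oppr_le0.
  by rewrite !mulr_ge0 // ltW.
(* Both sides are nonnegative here, so squaring preserves the comparison and removes the norm and
   the root of r^3 together. *)
rewrite -(@ler_pXn2r _ 2) // ?nnegrE.
- rewrite sqr_norm2 !exprMn rhoE sqrrN mulrC.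
  by rewrite (_ : 2 ^+ 2 = 4) // -natrX.
- exact: ltW.
- by rewrite ltW // !mulr_gt0 // oppr_gt0.
Qed.

(** The step length divides by the norm twice, once inside alpha, so a program can compute it from
    two dot products. *)
Lemma alpha_norm2E v :
  alpha Q v / norm2 (q_K Q v) = dot (q_K Q v) v / dot (q_K Q v) (q_K Q v).
Proof.
rewrite /alpha; set q := q_K Q v.
have [->|q0] := eqVneq q 0; first by rewrite !dot0l !mul0r.
by rewrite dotZl -sqr_norm2 expr2 invfM mulrA [_ * dot _ _]mulrC.
Qed.

(** Write s and N for the two dot products. Expanding the square shows that |v|^2 drops by c(2-c)
    s^2/N, and the test says 4 r^3 s^2/N >= 1. Scaling by 4 r^3 makes the guaranteed drop
    independent of r. *)
Lemma step_decrease (c : R) v (q := q_K Q v)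
    (v' := v - (c * (dot q v / dot q q)) *: q) :
  0 < c -> c < 2 -> dot q v < 0 ->
  dot q q <= 4 * r%:R ^+ 3 * dot q v ^+ 2 ->
  4 * r%:R ^+ 3 * dot v' v' <= 4 * r%:R ^+ 3 * dot v v - c * (2 - c).
Proof.
move=> c0 c2 s0 hq.
have q0 : 0 < dot q q.
  by apply: dot_gt0; apply: contraTneq s0 => ->; rewrite dot0l ltxx.
rewrite /v' !dotBl !dotBr !dotZl !dotZr (dotC v q).
move: s0 hq q0; set s := dot q v; set N := dot q q => s0 hq N0.
have -> : dot v v - c * (s / N) * s
    - (c * (s / N) * s - c * (s / N) * (c * (s / N) * N))
  = dot v v - c * (2 - c) * (s ^+ 2 / N) by field; rewrite gt_eqF.
rewrite mulrBr lerD2l lerN2 mulrCA ler_peMr //.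
  by apply: mulr_ge0; rewrite ?subr_ge0 ltW.
by rewrite mulrA ler_pdivlMr // mul1r.
Qed.

(** As [dot q v] is negative, the step adds a nonnegative multiple of [e_K v]. So y >= 1/r persists,
    which is what later makes the candidate set nonempty. *)
Lemma step_lower (c : R) v y (q := q_K Q v) (lo : R) :
  0 < c -> dot q v < 0 -> (forall i, lo <= y i 0) ->
  forall i, lo <= (y - (c * (dot q v / dot q q)) *: e_K v) i 0.
Proof.
move=> c0 s0 loy i; rewrite e_KE !mxE -mulNr ler_wpDr //.
rewrite mulr_ge0 //; last by case: ifP.
rewrite oppr_ge0 pmulr_rle0 // mulr_le0_ge0 ?invr_ge0 ?dot_ge0 //.
exact: ltW.
Qed.

(** This is minus the 1-norm of the negative part of v. *)
Lemma dot_e_K v : dot (e_K v) v = \sum_(i | v i 0 <= 0) v i 0.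
Proof.
rewrite e_KE /dot [RHS]big_mkcond; apply: eq_bigr => i _.
by rewrite mxE; case: ifP; rewrite ?mul1r ?mul0r.
Qed.

Lemma dot_q_K v : Q *m v = v -> dot (q_K Q v) v = dot (e_K v) v.
Proof. by move=> vE; rewrite dot_mulmxl Qsym vE. Qed.

(** Projecting does not lengthen, and |e_K|^2 = |K| <= r. It turns a refused test into a bound on
    [dot (e_K v) v] alone. *)
Lemma norm_q_K v : dot (q_K Q v) (q_K Q v) <= r%:R.
Proof.
apply: le_trans (dot_proj_le _) _; rewrite e_KE /dot.
rewrite -[X in _ <= X%:R]card_ord -sumr_const ler_sum // => i _.
by rewrite mxE; case: ifP; rewrite ?mul1r ?mul0r.
Qed.

(* If the step is refused then the negative part of v has 1-norm less than
   1/(2r), while v_j >= y_j >= 1/r for every j with z_j <= 0. *)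
Lemma small_bound_neq0 y (v := Q *m y) :
  (forall i, r%:R^-1 <= y i 0) -> ~~ pos_vec (y - v) ->
  - threshold R r < alpha Q v ->
  small_bound Q y != set0.
Proof.
move=> ylo /forallPn[j]; rewrite mxE [X in _ + X]mxE -leNgt subr_le0 => yvj Hal.
have r0 : (0 < r)%N := leq_ltn_trans (leq0n j) (ltn_ord j).
have rR : 0 < r%:R :> R by rewrite ltr0n.
have vj : r%:R^-1 <= v j 0 by apply: le_trans (ylo j) _.
have vj0 : 0 < v j 0 by rewrite (lt_le_trans _ vj) ?invr_gt0.
have vQ : Q *m v = v by rewrite /v mulmxA Qidem.
move: Hal; rewrite ltNge step_testE // negb_and negbK -ltNge.
rewrite dot_q_K //; set s := dot (e_K v) v => Hal.
(* For s < 0 the refused test reads 4 r^3 s^2 < |q_K|^2 <= r, that is, (2 r |s|)^2 < 1. *)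
have sle : - s <= (2 * r%:R)^-1.
  have [s0|s0] := leP 0 s.
    by rewrite (@le_trans _ _ 0) ?oppr_le0 // invr_ge0 mulr_ge0 // ltW.
  move: Hal; rewrite leNgt s0 /= => Hal.
  have : 4 * r%:R ^+ 3 * s ^+ 2 < r%:R := lt_le_trans Hal (norm_q_K v).
  rewrite exprSr mulrA mulrAC -ltr_pdivlMr // divff ?gt_eqF //.
  have -> : 4 * r%:R ^+ 2 * s ^+ 2 = (2 * r%:R * - s) ^+ 2 by ring.
  rewrite expr_lt1 ?mulr_ge0 ?oppr_ge0 ?(ltW s0) ?(ltW rR) // => H.
  by rewrite -[_^-1]mul1r ler_pdivlMr ?mulr_gt0 // mulrC ltW.
apply/set0Pn; exists j; rewrite inE -/v gt_eqF //= /bound -/v.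
(* Since v_j > 0, the entries with v_i > 0 give nonpositive quotients and drop out; the others add
   up to the negative part. The bound is then at most (1/(2r)) / (1/r) = 1/2. *)
have -> : \sum_i Num.max 0 (v i 0 / - v j 0) = - s / v j 0.
  rewrite /s dot_e_K -sumrN mulr_suml [RHS]big_mkcond; apply: eq_bigr => i _.
  rewrite invrN mulrN -mulNr; case: ifP => [vi|/negbT].
    by apply/max_idPr; rewrite divr_ge0 ?oppr_ge0 // ltW.
  rewrite -ltNge => vi; apply/max_idPl.
  by rewrite mulNr oppr_le0 divr_ge0 // ltW.
rewrite ler_pdivrMr // (le_trans sle) // invfM div1r.
by rewrite ler_pM2l ?invr_gt0.
Qed.

End BasicProcedure.

(** * Programs and their costs *)

Fixpoint bind X Y (p : prog X) (k : X -> prog Y) : prog Y :=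
  match p with
  | Ret x => k x
  | Arith o i j f => Arith o i j (fun a => bind (f a) k)
  | Leq i j f => Leq i j (fun b => bind (f b) k)
  end.

Notation "'let*' x ':=' p 'in' k" := (bind p (fun x => k))
  (at level 200, x name, p at level 100, k at level 200,
   format "'[v' 'let*'  x  ':='  p  'in' '/' k ']'").

Definition op o i j : prog nat := Arith o i j (@Ret nat).
Definition leq_test i j : prog bool := Leq i j (@Ret bool).

(** Each [f i] runs once; the returned look-up table can be consulted later without further
    operations. *)
Fixpoint tabulate_seq (I : eqType) X (f : I -> prog X) (x0 : X) (s : seq I) :
    prog (I -> X) :=
  if s is i :: s' then
    let* a := f i in
    let* g := tabulate_seq f x0 s' in
    Ret (fun j => if j == i then a else g j)
  else Ret (fun=> x0).

Definition pmatrix p q (f : 'I_p -> 'I_q -> prog nat) : prog 'M[nat]_(p, q) :=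
  let* g := tabulate_seq (fun ij => f ij.1 ij.2) 0%N (enum {: 'I_p * 'I_q}) in
  Ret (\matrix_(i, j) g (i, j)).

Definition pcol r (f : 'I_r -> prog nat) : prog 'cV[nat]_r :=
  pmatrix (fun i _ => f i).

Definition ptest r (f : 'I_r -> prog bool) : prog {set 'I_r} :=
  let* g := tabulate_seq f false (enum 'I_r) in
  Ret [set i | g i].

Fixpoint psum_seq (I : Type) (acc : nat) (f : I -> prog nat) (s : seq I) :
    prog nat :=
  if s is i :: s' then
    let* a := f i in
    let* acc' := op Add acc a in
    psum_seq acc' f s'
  else Ret acc.

Definition psum r zero (f : 'I_r -> prog nat) : prog nat :=
  psum_seq zero f (enum 'I_r).

(** * A program logic with operation counts *)

Section Logic.
Variable R : realType.
Implicit Types (mu : seq R) (T : nat).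

(* Memory only grows, so a fact about the contents of allocated cells is one
   that holds in every extension of the current memory. *)
Definition always (P : seq R -> Prop) mu := forall nu, prefix mu nu -> P nu.

(** A Hoare triple with a cost bound. The postcondition is required in every extension of the final
    memory, so it survives whatever runs afterwards. *)
Definition computes X mu (p : prog X) T (Post : X -> seq R -> Prop) : Prop :=
  let: (nu, x, t) := exec mu p in
  [/\ prefix mu nu, (t <= T)%N & always (Post x) nu].

Definition holds (x : R) (a : nat) mu := mu`_a = x.
Definition holds_mx p q (M : 'M[R]_(p, q)) (u : 'M[nat]_(p, q)) mu :=
  map_mx (nth 0 mu) u = M.

Lemma always_mono P mu nu : prefix mu nu -> always P mu -> always P nu.
Proof. by move=> mn Pm xi nx; apply: Pm; apply: prefix_trans nx. Qed.

Lemma computes_ret X (x : X) mu T (Post : X -> seq R -> Prop) :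
  always (Post x) mu -> computes mu (Ret x) T Post.
Proof. by move=> Px; split; rewrite ?prefix_refl. Qed.

Lemma computes_bind X Y (p : prog X) (k : X -> prog Y) mu T1 T2 P Post :
  computes mu p T1 P ->
  (forall nu x, prefix mu nu -> always (P x) nu -> computes nu (k x) T2 Post) ->
  computes mu (bind p k) (T1 + T2)%N Post.
Proof.
have execE : forall mu, exec mu (bind p k) =
    let: (nu, x, t) := exec mu p in
    let: (xi, y, t') := exec nu (k x) in (xi, y, (t + t')%N).
  elim: p => [x|o i j f IH|i j f IH] xi /=.
  - by case: exec => [[]].
  - rewrite IH; case: exec => [[nu x] t].
    by case: exec => [[]].
  - rewrite IH; case: exec => [[nu x] t].
    by case: exec => [[]].
rewrite /computes execE; case: exec => [[nu x] t] [mn tT Px] /(_ nu x mn Px).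
case: exec => [[xi y] t'] [nx t'T Py]; split=> //; last exact: leq_add.
exact: prefix_trans nx.
Qed.

#[global] Arguments bind : simpl never.

Lemma computes_weaken X (p : prog X) mu T T' (P P' : X -> seq R -> Prop) :
  (T <= T')%N -> (forall x nu, prefix mu nu -> P x nu -> P' x nu) ->
  computes mu p T P -> computes mu p T' P'.
Proof.
move=> TT PP; rewrite /computes; case: exec => [[nu x] t] [mn tT Px].
split=> // [|xi nx]; first exact: leq_trans TT.
by apply: PP; [exact: prefix_trans nx|exact: Px].
Qed.

Lemma computes_leq_time X (p : prog X) mu T T' (P : X -> seq R -> Prop) :
  (T <= T')%N -> computes mu p T P -> computes mu p T' P.
Proof. by move=> TT; exact: computes_weaken. Qed.

Lemma computes_op o i j x y mu :
  always (holds x i) mu -> always (holds y j) mu ->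
  computes mu (op o i j) 1 (holds (eval_arith o x y)).
Proof.
move=> ix jy; split; rewrite ?prefix_rcons // => nu /prefixP[s ->].
rewrite /holds nth_cat size_rcons ltnSn nth_rcons ltnn eqxx.
by rewrite (ix _ (prefix_refl _)) (jy _ (prefix_refl _)).
Qed.

Lemma computes_leq i j x y mu :
  always (holds x i) mu -> always (holds y j) mu ->
  computes mu (leq_test i j) 1 (fun b _ => b = (x <= y)).
Proof.
move=> ix jy; split; rewrite ?prefix_refl // => nu _.
by rewrite (ix _ (prefix_refl _)) (jy _ (prefix_refl _)).
Qed.

Lemma computes_tabulate_seq (I : eqType) X (f : I -> prog X) x0 s mu T
    (P : I -> X -> seq R -> Prop) :
  (forall i nu, prefix mu nu -> computes nu (f i) T (P i)) ->
  computes mu (tabulate_seq f x0 s) (size s * T)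
    (fun g nu => forall i, i \in s -> P i (g i) nu).
Proof.
elim: s mu => [|i s IH] mu Hf /=; first exact: computes_ret.
rewrite mulSn; apply: (computes_bind (Hf i mu (prefix_refl _))) => nu a mn Pa.
rewrite -[(size s * T)%N]addn0; apply: computes_bind.
  by apply: IH => j xi nx; apply: Hf; apply: prefix_trans nx.
move=> xi g nx Pg; apply: computes_ret => om xo j; rewrite inE.
case: eqVneq => [->|ji] /= js; last exact: Pg.
by apply: Pa; apply: prefix_trans xo.
Qed.

Arguments computes_tabulate_seq {I X f x0} s {mu T} P.

Lemma computes_pmatrix p q (f : 'I_p -> 'I_q -> prog nat) (M : 'M[R]_(p, q))
    mu T :
  (forall i j nu, prefix mu nu -> computes nu (f i j) T (holds (M i j))) ->
  computes mu (pmatrix f) (p * q * T) (holds_mx M).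
Proof.
move=> Hf; rewrite -[(_ * T)%N]addn0.
have -> : (p * q)%N = size (enum {: 'I_p * 'I_q}).
  by rewrite -cardE card_prod !card_ord.
apply: computes_bind.
  by apply: (computes_tabulate_seq _ (fun ij => holds (M ij.1 ij.2))) => ij;
     exact: Hf.
move=> nu g mn Hg; apply: computes_ret => xi nx.
by apply/matrixP => i j; rewrite !mxE (Hg xi nx) // mem_enum.
Qed.

Lemma computes_pcol r (f : 'I_r -> prog nat) (U : 'cV[R]_r) mu T :
  (forall i nu, prefix mu nu -> computes nu (f i) T (holds (U i 0))) ->
  computes mu (pcol f) (r * T) (holds_mx U).
Proof.
move=> Hf; rewrite -[r in (r * T)%N]muln1; apply: computes_pmatrix => i j.
by rewrite ord1; exact: Hf.
Qed.

Lemma computes_ptest r (f : 'I_r -> prog bool) (P : pred 'I_r) mu T :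
  (forall i nu, prefix mu nu -> computes nu (f i) T (fun b _ => b = P i)) ->
  computes mu (ptest f) (r * T) (fun S _ => S = [set i | P i]).
Proof.
move=> Hf; rewrite -[(r * T)%N]addn0 -[r in (r * T)%N]card_ord cardE.
apply: computes_bind.
  exact: (computes_tabulate_seq _ (fun i b (_ : seq R) => b = P i)).
move=> nu g mn Hg; apply: computes_ret => xi nx.
by apply/setP => i; rewrite !inE (Hg xi nx) // mem_enum.
Qed.

Lemma computes_psum_seq (I : Type) acc (f : I -> prog nat) (s : seq I)
    (x : R) (F : I -> R) mu T :
  always (holds x acc) mu ->
  (forall i nu, prefix mu nu -> computes nu (f i) T (holds (F i))) ->
  computes mu (psum_seq acc f s) (size s * T.+1)
    (holds (x + \sum_(i <- s) F i)).
Proof.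
elim: s acc x mu => [|i s IH] acc x mu Hx Hf /=.
  by apply: computes_ret; rewrite big_nil addr0.
rewrite mulSn addSnnS.
apply: (computes_bind (Hf i mu (prefix_refl _))) => nu a mn Ha.
rewrite -[(_ * _).+1]add1n; apply: computes_bind.
  exact: computes_op (always_mono mn Hx) Ha.
move=> xi b nx Hb; rewrite big_cons addrA; apply: IH => // j om xo.
by apply: Hf; apply: prefix_trans xo; apply: prefix_trans nx.
Qed.

Lemma computes_psum r zero (f : 'I_r -> prog nat) (F : 'I_r -> R) mu T :
  always (holds 0 zero) mu ->
  (forall i nu, prefix mu nu -> computes nu (f i) T (holds (F i))) ->
  computes mu (psum zero f) (r * T.+1) (holds (\sum_i F i)).
Proof.
move=> H0 Hf; have := computes_psum_seq (enum 'I_r) H0 Hf.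
by rewrite add0r big_enum -cardE card_ord.
Qed.

Lemma holds_mxP p q (M : 'M[R]_(p, q)) u mu :
  always (holds_mx M u) mu <-> forall i j, always (holds (M i j) (u i j)) mu.
Proof.
split=> [H i j nu mn|H nu mn]; first by rewrite -(H nu mn) /holds mxE.
by apply/matrixP => i j; rewrite mxE (H i j nu mn).
Qed.

End Logic.

(** Monotonicity of [always], applied to all facts about the old memory at once, plays the part of a
    frame rule. *)
Ltac lift mn :=
  lazymatch type of mn with
  | is_true (prefix ?mu ?nu) =>
      repeat match goal with
      | H : always _ mu |- _ => apply (always_mono mn) in H
      end
  end; clear mn.

(** * Vector operations and Gram-Schmidt as programs *)

Section VectorPrograms.
Variable R : realType.
Implicit Types (mu : seq R).

Definition holds_seq r (WS : seq 'cV[R]_r) (ws : seq 'cV[nat]_r) mu :=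
  map (map_mx (nth 0 mu)) ws = WS.

Lemma holds_entry p q (M : 'M[R]_(p, q)) u i j mu :
  always (holds_mx M u) mu -> always (holds (M i j) (u i j)) mu.
Proof. by move/holds_mxP. Qed.

Definition pdot r zero (u v : 'cV[nat]_r) : prog nat :=
  psum zero (fun i => op Mul (u i 0) (v i 0)).

Lemma computes_pdot r zero (u v : 'cV[nat]_r) (U V : 'cV[R]_r) mu :
  always (holds 0 zero) mu -> always (holds_mx U u) mu ->
  always (holds_mx V v) mu ->
  computes mu (pdot zero u v) (r * 2) (holds (dot U V)).
Proof.
move=> H0 Hu Hv; apply: computes_psum => // i nu mn; lift mn.
by apply: computes_op; exact: holds_entry.
Qed.

Definition psub r (u v : 'cV[nat]_r) : prog 'cV[nat]_r :=
  pcol (fun i => op Defs.Sub (u i 0) (v i 0)).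

Lemma computes_psub r (u v : 'cV[nat]_r) (U V : 'cV[R]_r) mu :
  always (holds_mx U u) mu -> always (holds_mx V v) mu ->
  computes mu (psub u v) r (holds_mx (U - V)).
Proof.
move=> Hu Hv; rewrite -[X in computes _ _ X]muln1.
apply: computes_pcol => // i nu mn; lift mn; rewrite mxE [X in _ + X]mxE.
by apply: (computes_op Defs.Sub); exact: holds_entry.
Qed.

Definition psub_scaled r a (x y : 'cV[nat]_r) : prog 'cV[nat]_r :=
  pcol (fun i => let* t := op Mul a (x i 0) in op Defs.Sub (y i 0) t).

Lemma computes_psub_scaled r a (x y : 'cV[nat]_r) (k : R) (X Y : 'cV[R]_r) mu :
  always (holds k a) mu -> always (holds_mx X x) mu ->
  always (holds_mx Y y) mu ->
  computes mu (psub_scaled a x y) (r * 2) (holds_mx (Y - k *: X)).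
Proof.
move=> Ha Hx Hy; apply: computes_pcol => // i nu mn; lift mn.
rewrite mxE [X in _ + X]mxE [X in _ - X]mxE.
rewrite -[2%N]/(1 + 1)%N; apply: computes_bind.
  by apply: computes_op; [exact: Ha|exact: holds_entry Hx].
move=> xi t mn Ht; lift mn.
by apply: (computes_op Defs.Sub); [exact: holds_entry|].
Qed.

(** The coefficients come from the fixed [x] while [acc] shrinks, so the result matches [proj]
    literally. The residual is what Gram-Schmidt stores, and one subtraction recovers the projection
    from it. *)
Fixpoint presidual r zero (acc : 'cV[nat]_r) (ws : seq 'cV[nat]_r) x :
    prog 'cV[nat]_r :=
  if ws is w :: ws' then
    let* s := pdot zero x w in
    let* n := pdot zero w w in
    let* k := op Div s n in
    let* acc' := psub_scaled k w acc in
    presidual zero acc' ws' x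
  else Ret acc.

Lemma computes_presidual r zero (acc x : 'cV[nat]_r) ws (Acc X : 'cV[R]_r)
    WS mu :
  always (holds 0 zero) mu -> always (holds_mx Acc acc) mu ->
  always (holds_seq WS ws) mu -> always (holds_mx X x) mu ->
  computes mu (presidual zero acc ws x) (size ws * (6 * r + 1))
    (holds_mx (Acc - proj WS X)).
Proof.
elim: ws acc Acc WS mu => [|w ws IH] acc Acc WS mu H0 Hacc Hws Hx /=.
  apply: computes_ret => nu mn; rewrite -(Hws _ mn) /proj big_nil subr0.
  exact: Hacc.
pose W := map_mx (nth 0 mu) w; pose WS' := map (map_mx (nth 0 mu)) ws.
have Hw : always (holds_mx W w) mu.
  move=> nu mn; have := Hws _ mn; rewrite -(Hws _ (prefix_refl _)).
  by case.
have {}Hws : always (holds_seq WS' ws) mu /\ WS = W :: WS'.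
  split; last by rewrite -(Hws _ (prefix_refl _)).
  move=> nu mn; have := Hws _ mn; rewrite -(Hws _ (prefix_refl _)).
  by case.
case: Hws => Hws ->; clearbody W WS'.
(* One basis vector costs two dot products, a division and a scaled subtraction: [6 * r + 1]. *)
apply: (@computes_leq_time _ _ _ _
   (r * 2 + (r * 2 + (1 + (r * 2 + size ws * (6 * r + 1)))))).
  by lia.
apply: computes_bind; first exact: (computes_pdot H0 Hx Hw).
move=> nu s mn Hs; lift mn.
apply: computes_bind; first exact: (computes_pdot H0 Hw Hw).
move=> {mu}mu n mn Hn; lift mn.
apply: computes_bind; first exact: computes_op Hs Hn.
move=> {nu}nu k mn Hk; lift mn.
apply: computes_bind; first exact: computes_psub_scaled Hk Hw Hacc.
move=> {mu}mu a mn Ha; lift mn.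
rewrite /proj big_cons opprD addrA.
exact: IH.
Qed.

Definition pproj r zero ws (x : 'cV[nat]_r) : prog 'cV[nat]_r :=
  let* t := presidual zero x ws x in psub x t.

Lemma computes_pproj r zero ws (x : 'cV[nat]_r) (X : 'cV[R]_r) WS mu :
  always (holds 0 zero) mu -> always (holds_seq WS ws) mu ->
  always (holds_mx X x) mu ->
  computes mu (pproj zero ws x) (size ws * (6 * r + 1) + r)
    (holds_mx (proj WS X)).
Proof.
move=> H0 Hws Hx; apply: computes_bind.
  exact: (computes_presidual H0 Hx Hws Hx).
move=> nu t mn Ht; lift mn; rewrite -[proj _ _](subKr X).
exact: computes_psub.
Qed.

Fixpoint pgram_schmidt r zero (ws s : seq 'cV[nat]_r) : prog (seq 'cV[nat]_r) :=
  if s is a :: s' then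
    let* w := presidual zero a ws a in
    pgram_schmidt zero (rcons ws w) s'
  else Ret ws.

(** [k] bounds the length of the basis at every stage, so each residual is charged as if the basis
    were already complete. *)
Lemma computes_pgram_schmidt r zero (ws s : seq 'cV[nat]_r)
    (WS S : seq 'cV[R]_r) k mu :
  always (holds 0 zero) mu -> always (holds_seq WS ws) mu ->
  always (holds_seq S s) mu -> (size ws + size s <= k)%N ->
  computes mu (pgram_schmidt zero ws s) (size s * (k * (6 * r + 1)))
    (holds_seq (foldl (fun ws a => rcons ws (a - proj ws a)) WS S)).
Proof.
elim: s S ws WS mu => [|a s IH] S ws WS mu H0 Hws Hs /= szk.
  by apply: computes_ret => nu mn; rewrite -(Hs _ mn); exact: Hws.
have [A [S' [Ha {}Hs ->]]] : exists A S',
    [/\ always (holds_mx A a) mu, always (holds_seq S' s) mu & S = A :: S'].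
  have HS := Hs _ (prefix_refl _).
  exists (map_mx (nth 0 mu) a), (map (map_mx (nth 0 mu)) s).
  by split=> // nu mn; have := Hs _ mn; rewrite -HS; case.
rewrite mulSn; apply: computes_bind.
  apply: computes_leq_time (computes_presidual H0 Ha Hws Ha).
  by rewrite leq_mul2r; apply/orP; right; lia.
move=> nu w mn Hw; lift mn; apply: (IH S' _ (rcons WS _)) => //; last first.
  by rewrite size_rcons; lia.
move=> xi mn; rewrite /holds_seq map_rcons.
have := Hws xi mn; rewrite /holds_seq => ->.
by have := Hw xi mn; rewrite /holds_mx => ->.
Qed.

End VectorPrograms.

(** * The Basic Procedure as a program *)

Lemma always_const (R : realType) (P : Prop) (mu : seq R) :
  always (fun=> P) mu -> P.
Proof. by apply; exact: prefix_refl. Qed.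

Lemma always_eq (R : realType) (T : Type) (F : seq R -> T) x mu nu :
  always (fun xi => F xi = x) mu -> prefix mu nu ->
  always (fun xi => F xi = F nu) nu.
Proof.
by move=> Fx mn xi nx; rewrite (Fx _ mn) Fx // (prefix_trans mn).
Qed.

(** The bound depends on y through v = Q y alone. It is also evaluated where v_j = 0, the quotient
    by zero being 0; the last two comparisons then reject that j. *)
Definition psmall_bound r zero half (v : 'cV[nat]_r) : prog {set 'I_r} :=
  ptest (fun j =>
    let* nv := op Defs.Sub zero (v j 0) in
    let* b := psum zero (fun i =>
      let* d := op Div (v i 0) nv in
      let* p := leq_test zero d in
      Ret (if p then d else zero)) in
    let* l := leq_test b half in
    let* n1 := leq_test (v j 0) zero in
    let* n2 := leq_test zero (v j 0) in
    Ret (~~ (n1 && n2) && l)).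

Lemma computes_psmall_bound (R : realType) r zero half (v : 'cV[nat]_r)
    (Q : 'M[R]_r) (Y : 'cV[R]_r) mu :
  always (holds 0 zero) mu -> always (holds (1 / 2) half) mu ->
  always (holds_mx (Q *m Y) v) mu ->
  computes mu (psmall_bound zero half v) (r * (3 * r + 4))
    (fun S _ => S = small_bound Q Y).
Proof.
move=> H0 Hh Hv; apply: computes_ptest => j nu mn; lift mn.
have Hvi i nu' (mn : prefix nu nu') := always_mono mn (holds_entry i 0 Hv).
apply: (@computes_leq_time _ _ _ _
  (1 + (r * (1 + (1 + 0)).+1 + (1 + (1 + (1 + 0)))))).
  by lia.
apply: computes_bind.
  exact: (computes_op Defs.Sub H0 (Hvi j _ (prefix_refl _))).
move=> xi nv mn; lift mn => Hnv; rewrite /= sub0r in Hnv.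
apply: computes_bind.
  apply: (@computes_psum _ _ _ _
    (fun i => Num.max 0 ((Q *m Y) i 0 / - (Q *m Y) j 0))) => // i om mn.
  lift mn; have {}Hvi := holds_entry i 0 Hv.
  apply: computes_bind; first exact: (computes_op Div Hvi Hnv).
  move=> rho d mn Hd; lift mn.
  apply: computes_bind; first exact: (computes_leq H0 Hd).
  move=> pi b mn /always_const ->; lift mn.
  by apply: computes_ret; rewrite maxEle; case: ifP.
move=> pi b mn Hb; lift mn.
apply: computes_bind; first exact: (computes_leq Hb Hh).
move=> om l mn /always_const ->; lift mn.
have {}Hvi := holds_entry j 0 Hv.
apply: computes_bind; first exact: (computes_leq Hvi H0).
move=> ka n1 mn /always_const ->; lift mn.
apply: computes_bind; first exact: (computes_leq H0 Hvi).
move=> la n2 mn /always_const ->; lift mn.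
apply: computes_ret => _ _.
by rewrite -eq_le.
Qed.

(** For U = v this is the set K, so the comparisons that decide v > 0 also determine K. *)
Definition nonpos_set (R : realType) r (U : 'cV[R]_r) : {set 'I_r} :=
  [set i | U i 0 <= 0].

Lemma pos_vecE (R : realType) r (U : 'cV[R]_r) :
  pos_vec U = (nonpos_set U == set0).
Proof.
apply/forallP/eqP => [U0|/setP U0 i].
  by apply/setP => i; rewrite !inE leNgt U0.
by have := U0 i; rewrite !inE leNgt => /negbFE.
Qed.

Definition pnonpos r zero (u : 'cV[nat]_r) : prog {set 'I_r} :=
  ptest (fun i => leq_test (u i 0) zero).

Lemma computes_pnonpos (R : realType) r zero u (U : 'cV[R]_r) mu :
  always (holds 0 zero) mu -> always (holds_mx U u) mu ->
  computes mu (pnonpos zero u) r (fun S _ => S = nonpos_set U).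
Proof.
move=> H0 Hu; rewrite -[X in computes _ _ X]muln1; apply: computes_ptest.
by move=> i nu mn; lift mn; apply: computes_leq => //; exact: holds_entry.
Qed.

(* [one] and [cc] are the addresses of 1 and c, [k4] that of 4 r^3. *)
Fixpoint pbasic zero one cc k4 half r (full : bool)
    (choose : {set 'I_r} -> {set 'I_r}) (ws : seq 'cV[nat]_r)
    (fuel : nat) (y v : 'cV[nat]_r) :
    prog (seq (iterate nat r) * iterate nat r * bp_case r) :=
  if fuel is f.+1 then
    let* z := psub y v in
    let* nz := pnonpos zero z in
    if nz == set0 then Ret ([::], Iterate y v z, Case1 r) else
    let* K := pnonpos zero v in
    if (K == set0) && full then Ret ([::], Iterate y v z, Case2 r) else
    let e := \col_i (if i \in K then one else zero) in
    let* q := pproj zero ws e in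
    let* s := pdot zero q v in
    let* n := pdot zero q q in
    let* s2 := op Mul s s in
    let* t := op Mul k4 s2 in
    let* s_ge0 := leq_test zero s in
    let* big := leq_test n t in
    if ~~ s_ge0 && big then
      let* a := op Div s n in
      let* ca := op Mul cc a in
      let* y' := psub_scaled ca e y in
      let* v' := psub_scaled ca q v in
      let* res := pbasic zero one cc k4 half full choose ws f y' v' in
      Ret (Iterate y v z :: res.1.1, res.1.2, res.2)
    else
      let* S := psmall_bound zero half v in
      Ret ([::], Iterate y v z, Case0 (choose S))
  else Ret ([::], Iterate y v v, Case1 r).

Section PBasic.
Variables (R : realType) (c : R) (zero one cc k4 half r : nat) (full : bool).
Variables (choose : {set 'I_r} -> {set 'I_r}) (WS : seq 'cV[R]_r).
Hypotheses (c_gt0 : 0 < c) (c_lt2 : c < 2) (WSorth : orthogonal_seq WS).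
Hypothesis chooseP : forall S, S != set0 ->
  (choose S != set0) && (choose S \subset S).
Let Q := projmx WS.

(* The last clause keeps the returned iterate readable after later writes. *)
Definition basic_post (Y V : 'cV[R]_r)
    (res : seq (iterate nat r) * iterate nat r * bp_case r) (mu : seq R) :=
  let f := nth 0 mu in
  [/\ bp_run c full Q Y V (map (@map_iterate _ _ f r) res.1.1)
        (map_iterate f res.1.2) res.2,
  forall J, res.2 = Case0 J ->
     let S := small_bound Q (map_mx f (it_y res.1.2)) in
     S != set0 /\ J = choose S &
  always (fun nu => map_iterate (nth 0 nu) res.1.2 = map_iterate f res.1.2) mu].

(** The first term is the projection of [e_K]. The [12 * r] collects z, two sign tests, the
    subtraction closing the projection, two dot products and two updates. *)
Definition iter_cost := (size WS * (6 * r + 1) + 12 * r + 6)%N.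

(** The last premise is the termination argument: a step lowers its left side by at least c(2-c) and
    its right side by exactly c(2-c), and with no fuel left it would make a squared norm
    negative. *)
Lemma computes_pbasic ws fuel y v (Y V : 'cV[R]_r) mu :
  always (holds 0 zero) mu -> always (holds 1 one) mu ->
  always (holds c cc) mu -> always (holds (4 * r%:R ^+ 3) k4) mu ->
  always (holds (1 / 2) half) mu ->
  always (holds_seq WS ws) mu ->
  always (holds_mx Y y) mu -> always (holds_mx V v) mu ->
  V = Q *m Y -> (forall i, r%:R^-1 <= Y i 0) ->
  4 * r%:R ^+ 3 * dot V V < fuel%:R * (c * (2 - c)) ->
  computes mu (pbasic zero one cc k4 half full choose ws fuel y v)
    (fuel * iter_cost + r * (3 * r + 4)) (basic_post Y V).
Proof.
have Qsym : Q^T = Q by exact: projmx_tr.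
have Qidem : Q *m Q = Q by exact: projmx_idem.
have cpos : 0 < c * (2 - c) by rewrite mulr_gt0 // subr_gt0.
elim: fuel y v Y V mu => [|fuel IH] y v Y V mu H0 H1 Hc Hk Hh Hws Hy Hv VE Ylo.
  by rewrite mul0r ltNge !mulr_ge0 ?dot_ge0 // exprn_ge0.
move=> dec /=.
have sz : size ws = size WS by rewrite -(Hws _ (prefix_refl _)) size_map.
apply: (@computes_leq_time _ _ _ _ (r + (r + (r + (size ws * (6 * r + 1) + r
  + (r * 2 + (r * 2 + (1 + (1 + (1 + (1 + (1 + (1 + (r * 2 + (r * 2 +
  (fuel * iter_cost + r * (3 * r + 4) + 0)))))))))))))))%N).
  by rewrite sz [(fuel.+1 * _)%N]mulSn {2}/iter_cost; lia.
apply: computes_bind; first exact: (computes_psub Hy Hv).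
move=> nu z mn Hz; lift mn.
have itE : always (fun xi =>
    map_iterate (nth 0 xi) (Iterate y v z) = current_iterate Y V) nu.
  move=> xi mn; rewrite /map_iterate /=.
  by congr Iterate; [exact: Hy|exact: Hv|exact: Hz].
apply: computes_bind; first exact: (computes_pnonpos H0 Hz).
move=> {}mu nz mn /always_const ->; lift mn; rewrite -pos_vecE.
case: ifP => [z0|/negbT z0].
  apply: computes_ret => xi mn; split=> //=; last exact: (always_eq itE mn).
  rewrite (itE _ mn).
  exact: BpPrimal.
(* An empty z counts as positive, so r = 0 has already returned with case 1. *)
have r0 : (0 < r)%N.
  by case/forallPn: z0 => i _; apply: leq_ltn_trans (ltn_ord i).
apply: computes_bind; first exact: (computes_pnonpos H0 Hv).
move=> {}nu K mn /always_const ->; lift mn; rewrite -pos_vecE.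
case: ifP => [v0|/negbT v0].
  apply: computes_ret => xi mn; split=> //=; last exact: (always_eq itE mn).
  rewrite (itE _ mn).
  exact: BpDual.
(* Assembled from the addresses of 0 and 1, this vector costs no operation. *)
set e := \col_i _.
have He : always (holds_mx (e_K V) e) nu.
  apply/holds_mxP => i j xi mn; rewrite e_KE ord1 /holds !mxE inE.
  by case: ifP => _; [exact: H1|exact: H0].
apply: computes_bind; first exact: (computes_pproj H0 Hws He).
move=> {}mu q mn Hq; rewrite -projmxE -/Q -/(q_K Q V) in Hq; lift mn.
apply: computes_bind; first exact: (computes_pdot H0 Hq Hv).
move=> {}nu s mn Hs; lift mn.
apply: computes_bind; first exact: (computes_pdot H0 Hq Hq).
move=> {}mu n mn Hn; lift mn.
apply: computes_bind; first exact: (computes_op Mul Hs Hs).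
move=> {}nu s2 mn Hs2; lift mn.
apply: computes_bind; first exact: (computes_op Mul Hk Hs2).
move=> {}mu t mn Ht; lift mn; rewrite /= -expr2 in Ht.
apply: computes_bind; first exact: (computes_leq H0 Hs).
move=> {}nu s_ge0 mn /always_const ->; lift mn.
apply: computes_bind; first exact: (computes_leq Hn Ht).
move=> {}mu big mn /always_const ->; lift mn.
rewrite -step_testE //; case: ifPn => [step|cut]; last first.
  rewrite -ltNge in cut.
  apply: (@computes_leq_time _ _ _ _ (r * (3 * r + 4) + 0)); first by lia.
  rewrite VE in Hv; apply: computes_bind.
    exact: (computes_psmall_bound H0 Hh Hv).
  move=> {}nu S mn /always_const ->; lift mn.
  have S0 : small_bound Q Y != set0.
    by apply: small_bound_neq0 => //; rewrite -?VE.
  have /andP[J0 JS] := chooseP S0.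
  apply: computes_ret => xi mn; split=> [|J [<-]|] /=;
    last exact: (always_eq itE mn).
    by rewrite (itE _ mn); exact: BpCut.
  by have := Hy _ mn; rewrite /holds_mx => ->.
apply: computes_bind; first exact: (computes_op Div Hs Hn).
move=> {}nu a mn Ha; lift mn.
apply: computes_bind; first exact: (computes_op Mul Hc Ha).
move=> {}mu ca mn Hca; lift mn; rewrite /= in Hca.
apply: computes_bind; first exact: (computes_psub_scaled Hca He Hy).
move=> {}nu y' mn Hy'; lift mn.
apply: computes_bind; first exact: (computes_psub_scaled Hca Hq Hv).
move=> {}mu v' mn Hv'; lift mn.
have := step; rewrite step_testE // -ltNge => /andP[s_lt0 nle].
apply: computes_bind.
  apply: IH Hy' Hv' _ _ _ => //.
  - by rewrite mulmxBr -VE -scalemxAr.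
  - exact: step_lower.
  - apply: le_lt_trans (step_decrease c_gt0 c_lt2 s_lt0 nle) _.
    by rewrite ltrBlDr -[X in _ + X]mul1r -mulrDl -mulrSr.
move=> {}nu [[its ret] case] mn Hres; lift mn.
apply: computes_ret => xi mn; have [/= Hrun Hch Hst] := Hres _ mn.
split=> //=; rewrite (itE _ mn); apply: BpStep => //.
by rewrite !alpha_norm2E.
Qed.
End PBasic.

(** * One call of the Basic Procedure with its preparation *)

Definition pprojmx r zero one (ws : seq 'cV[nat]_r) : prog 'M[nat]_r :=
  let* g := tabulate_seq
    (fun j => pproj zero ws (\col_i (if i == j then one else zero)))
    (const_mx 0%N) (enum 'I_r) in
  Ret (\matrix_(i, j) g j i 0).

(** The round records Q as a matrix. Its columns are the projected unit vectors, at a cost of O(m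
    r^2) once per round; the iterations apply the basis instead. *)
Lemma computes_pprojmx (R : realType) r zero one ws (WS : seq 'cV[R]_r) mu :
  always (holds 0 zero) mu -> always (holds 1 one) mu ->
  always (holds_seq WS ws) mu ->
  computes mu (pprojmx zero one ws) (r * (size ws * (6 * r + 1) + r))
    (holds_mx (projmx WS)).
Proof.
move=> H0 H1 Hws; rewrite -[(r * _)%N]addn0 -[r in (r * _)%N]card_ord cardE.
apply: computes_bind.
  apply: (@computes_tabulate_seq _ _ _ _ _ _ _ _
    (fun j => holds_mx (col j (projmx WS)))).
  move=> j nu mn; lift mn; rewrite colE projmxE; apply: computes_pproj => //.
  apply/holds_mxP => i k xi mn; rewrite ord1 /holds !mxE eqxx andbT.
  by case: eqP => _; [exact: H1|exact: H0].
move=> nu g mn Hg; apply: computes_ret => xi nx.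
apply/matrixP => i j; have := Hg xi nx j (mem_enum _ _).
by rewrite /holds_mx => /colP/(_ i); rewrite !mxE.
Qed.

(** The real number r is the sum of r ones, and 1/r and 4 r^3 are derived from it. The fuel
    [C * r ^ 2 + 1] covers an initial potential of at most 4 r^2, and the extra 1 makes the
    comparison strict. *)
Definition pround zero one cc two half C m r (full : bool)
    (choose : {set 'I_r} -> {set 'I_r}) (A : 'M[nat]_(m, r)) :
    prog ('M[nat]_r * (seq (iterate nat r) * iterate nat r * bp_case r)) :=
  let* ws := pgram_schmidt zero [::] (rows_of A) in
  let* Q := pprojmx zero one ws in
  let* a := psum zero (fun _ : 'I_r => Ret one) in
  let* b := op Div one a in
  let y := const_mx b in
  let* v := pproj zero ws y in
  let* four := op Add two two in
  let* a2 := op Mul a a in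
  let* a3 := op Mul a2 a in
  let* k4 := op Mul four a3 in
  let* res :=
    pbasic zero one cc k4 half full choose ws (C * r ^ 2 + 1) y v in
  Ret (Q, res).

Section PRound.
Variables (R : realType) (c : R) (zero one cc two half C m r : nat).
Variables (full : bool) (choose : {set 'I_r} -> {set 'I_r}).
Hypotheses (c_gt0 : 0 < c) (c_lt2 : c < 2).
Hypothesis C_large : 4 <= C%:R * (c * (2 - c)).
Hypothesis chooseP : forall S, S != set0 ->
  (choose S != set0) && (choose S \subset S).

Definition round_post (A : 'M[R]_(m, r))
    (res : 'M[nat]_r * (seq (iterate nat r) * iterate nat r * bp_case r))
    (mu : seq R) :=
  let f := nth 0 mu in
  let Q := map_mx f res.1 in
  [/\ is_Q A Q,
      basic_procedure c full Q (map (@map_iterate _ _ f r) res.2.1.1)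
        (map_iterate f res.2.1.2) res.2.2,
      forall J, res.2.2 = Case0 J ->
      let S := small_bound Q (map_mx f (it_y res.2.1.2)) in
      S != set0 /\ J = choose S &
      always (fun nu => map_iterate (nth 0 nu) res.2.1.2 =
                        map_iterate f res.2.1.2) mu].

Definition basic_cost :=
  ((C * r ^ 2 + 1) * (m * (6 * r + 1) + 12 * r + 6) + r * (3 * r + 4))%N.

(** The [r.+1] projections are the columns of Q and the initial v. *)
Definition round_cost :=
  (m * (m * (6 * r + 1)) + (r.+1 * (m * (6 * r + 1) + r) + r + 5) +
   basic_cost)%N.

Lemma computes_pround a (A : 'M[R]_(m, r)) mu :
  always (holds 0 zero) mu -> always (holds 1 one) mu ->
  always (holds c cc) mu -> always (holds 2 two) mu ->
  always (holds (1 / 2) half) mu -> always (holds_mx A a) mu ->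
  computes mu (pround zero one cc two half C full choose a) round_cost
    (round_post A).
Proof.
move=> H0 H1 Hc H2 Hh HA.
have szr : size (rows_of a) = m by rewrite size_map -cardE card_ord.
have szR : size (rows_of A) = m by rewrite size_map -cardE card_ord.
set WS := gram_schmidt (rows_of A).
have szWS : size WS = m by rewrite size_gram_schmidt.
have WSorth : orthogonal_seq WS := gram_schmidt_orthogonal _.
apply: (@computes_leq_time _ _ _ _ (m * (m * (6 * r + 1)) +
  (r * (m * (6 * r + 1) + r) + (r * 1 + (1 + ((m * (6 * r + 1) + r) +
  (1 + (1 + (1 + (1 + (basic_cost + 0))))))))))%N).
  by rewrite /round_cost; nia.
have Hrows : always (holds_seq (rows_of A) (rows_of a)) mu.
  move=> nu mn; rewrite /holds_seq /rows_of -map_comp.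
  apply: eq_map => i /=; rewrite -map_trmx map_row.
  by have := HA _ mn; rewrite /holds_mx => ->.
have Hnil : always (holds_seq (Nil 'cV[R]_r) [::]) mu by [].
have := computes_pgram_schmidt H0 Hnil Hrows (leqnn _).
rewrite szr => /computes_bind; apply.
move=> nu ws mn; rewrite -/(gram_schmidt _) -/WS => Hws; lift mn.
have szw : size ws = m.
  by rewrite -szWS -(Hws _ (prefix_refl _)) size_map.
have := computes_pprojmx H0 H1 Hws; rewrite szw => /computes_bind; apply.
move=> {}mu Q mn HQ; lift mn.
apply: computes_bind.
  apply: (@computes_psum _ _ _ _ (fun=> 1) _ 0) => // i xi mn; lift mn.
  exact: computes_ret.
move=> {}nu n mn; rewrite sumr_const card_ord => Hn; lift mn.
apply: computes_bind; first exact: (computes_op Div H1 Hn).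
move=> {}mu b mn Hb; rewrite /= div1r in Hb; lift mn.
have Hy : always (holds_mx (const_mx (r%:R^-1)) (const_mx b : 'cV_r)) mu.
  by apply/holds_mxP => i j; rewrite !mxE.
have := computes_pproj H0 Hws Hy; rewrite szw => /computes_bind; apply.
move=> {}nu v mn Hv; rewrite -projmxE in Hv; lift mn.
apply: computes_bind; first exact: (computes_op Add H2 H2).
move=> {}mu four mn Hf; lift mn.
apply: computes_bind; first exact: (computes_op Mul Hn Hn).
move=> {}nu n2 mn Hn2; lift mn.
apply: computes_bind; first exact: (computes_op Mul Hn2 Hn).
move=> {}mu n3 mn Hn3; lift mn.
apply: computes_bind; first exact: (computes_op Mul Hf Hn3).
move=> {}nu k4 mn Hk; lift mn.
have kE : eval_arith Mul (eval_arith Add 2 2)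
   (eval_arith Mul (eval_arith Mul r%:R r%:R) r%:R) = 4 * r%:R ^+ 3 :> R.
  by rewrite /=; ring.
rewrite kE in Hk.
have := @computes_pbasic _ c zero one cc k4 half r full choose WS c_gt0 c_lt2
  WSorth chooseP ws (C * r ^ 2 + 1) _ v _ _ nu H0 H1 Hc Hk Hh Hws Hy Hv.
rewrite /iter_cost szWS => /(_ erefl) Hbasic.
apply: computes_bind; first apply: Hbasic.
- by move=> i; rewrite mxE.
(* Here |Q y|^2 <= |y|^2 = r (1/r)^2, so 4 r^3 |v|^2 <= 4 r^2, and [C_large] turns the factor 4 into
   C c(2-c). *)
- apply: (@le_lt_trans _ _ (4 * r%:R ^+ 2)).
    rewrite exprS !mulrA [4 * _ * _]mulrAC -mulrA ler_piMr //.
      by rewrite !mulr_ge0.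
    apply: le_trans (ler_wpM2l _ (dot_proj_le _ _ _)) _ => //.
    + exact: projmx_tr.
    + exact: projmx_idem.
    rewrite dot_const mulrA -expr2 -exprMn.
    have [->|r0] := eqVneq (r%:R : R) 0; first by rewrite mul0r expr0n.
    by rewrite divff // expr1n.
  rewrite natrD natrM natrX [ltRHS]mulrDl mul1r [C%:R * _ * _]mulrAC.
  rewrite ltr_pwDr ?mulr_gt0 ?subr_gt0 //.
  by rewrite ler_wpM2r // exprn_ge0.
move=> {}mu res mn Hres; lift mn; apply: computes_ret => xi mn.
have [Hrun Hcase Hst] := Hres _ mn.
have QE : map_mx (nth 0 xi) Q = projmx WS := HQ _ mn.
split=> /=; rewrite ?QE //.
exact: gram_schmidt_is_Q.
Qed.

End PRound.

(** * The main loop *)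

(* After k_i halvings d_i = 2^-k_i, and column i is deleted when k_i reaches L;
   the potential is the number of halvings left. *)
Definition halvings_left (R : realType) n L (d : 'cV[R]_n) (H : {set 'I_n})
    (p : nat) : Prop :=
  exists k : 'I_n -> nat,
    [/\ forall i, i \in H -> d i 0 = 0,
        forall i, i \notin H -> d i 0 = 2 ^- k i /\ (k i < L)%N &
        (\sum_(i | i \notin H) (L - k i) <= p)%N].

Lemma halvings_left_init (R : realType) n L : (0 < L)%N ->
  halvings_left (R := R) L (const_mx 1) (set0 : {set 'I_n}) (n * L).
Proof.
move=> L0; exists (fun=> 0%N); split=> [i|i _|]; rewrite ?inE //.
  by rewrite mxE expr0 invr1.
rewrite (eq_bigl predT) => [|i]; last by rewrite inE.
by rewrite sum_nat_const subn0 card_ord.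
Qed.

Lemma orig_setS (V : Type) m n (st : mstate V m n) (J : {set 'I_(ncols st)}) i :
  i \in orig_set J -> i \notin ms_H st.
Proof. by case/imsetP => j _ ->; have := enum_valP j; rewrite inE. Qed.

(** A remaining column has k_i < L, hence a positive term. For a member of J the term drops by one
    or disappears with the column, the other terms do not grow, and J is nonempty. *)
Lemma halvings_left_rescale (R : realType) m n L (st : mstate R m n)
    (J : {set 'I_(ncols st)}) p (st' := rescale (2 ^- L) J) :
  J != set0 -> halvings_left L (ms_d st) (ms_H st) p ->
  (0 < p)%N /\ halvings_left L (ms_d st') (ms_H st') p.-1.
Proof.
case/set0Pn => j jJ [k [dH dnH sump]].
pose J' := orig_set J.
have jJ' : orig j \in J' by apply: imset_f.
have HJ' i : i \in ms_H st -> i \notin J'.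
  by apply: contraL; exact: orig_setS.
pose k' i := (if i \in J' then (k i).+1 else k i).
pose d1 i := (if i \in J' then ms_d st i 0 / 2 else ms_d st i 0).
have d1E i : i \notin ms_H st -> d1 i = 2 ^- k' i.
  move=> /dnH[dE _]; rewrite /d1 /k' dE; case: ifP => // _.
  by rewrite exprSr invfM.
have HE i : (i \in ms_H st') = (d1 i <= 2 ^- L) by rewrite inE mxE.
(* H is recomputed from scratch, but a deleted column has d_i = 0 <= 2^-L and so stays deleted. *)
have HH i : i \in ms_H st -> i \in ms_H st'.
  move=> iH; rewrite HE /d1 (negPf (HJ' _ iH)) dH // invr_ge0.
  by rewrite exprn_ge0.
have nHH i : i \notin ms_H st' -> i \notin ms_H st.
  by apply: contra; exact: HH.
have kL i : i \notin ms_H st' -> (k' i < L)%N.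
  move=> iH; have := iH; rewrite HE d1E ?nHH // -ltNge.
  by rewrite ltf_pV2 ?posrE ?exprn_gt0 // ltr_eXn2l // ltr1n.
have lt : (\sum_(i | i \notin ms_H st') (L - k' i) <
           \sum_(i | i \notin ms_H st) (L - k i))%N.
  have jH : orig j \notin ms_H st by exact: orig_setS jJ'.
  have [_ kjL] := dnH _ jH.
  rewrite [X in (_ < X)%N](bigD1 (orig j)) //= big_mkcond (bigD1 (orig j)) //=.
  rewrite -addSn leq_add //.
    by case: ifP => _; rewrite ?/k' ?jJ'; lia.
  rewrite [X in (_ <= X)%N]big_mkcondl /= leq_sum // => i _.
  case: ifP => [/nHH ->|_] //.
  by rewrite /k'; case: ifP => _ //; lia.
split; first by lia.
exists k'; split=> [i iH|i iH|]; last by lia.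
- by rewrite mxE -[X in if X then _ else _]/(i \in ms_H st') iH.
- split; last exact: kL.
  rewrite mxE -[X in if X then _ else _]/(i \in ms_H st') (negPf iH) mxE.
  exact: d1E (nHH _ iH).
Qed.

(** The selector speaks of original indices, the Basic Procedure of positions among the remaining
    columns; the choice is pulled back along the injection [orig]. Nothing is lost, as a valid
    selector stays in the image of S. *)
Definition choose_J (V : Type) m n (st : mstate V m n) (sel : selector n) k
    (S : {set 'I_(ncols st)}) : {set 'I_(ncols st)} :=
  [set j | orig j \in sel k (orig_set S)].

Lemma orig_set_neq0 (V : Type) m n (st : mstate V m n)
    (S : {set 'I_(ncols st)}) : (orig_set S != set0) = (S != set0).
Proof.
apply/set0Pn/set0Pn => [[i /imsetP[j jS _]]|[j jS]]; first by exists j.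
by exists (orig j); apply: imset_f.
Qed.

Lemma orig_set_choose_J (V : Type) m n (st : mstate V m n) (sel : selector n) k
    (S : {set 'I_(ncols st)}) : valid_selector sel -> S != set0 ->
  orig_set (choose_J sel k S) = sel k (orig_set S).
Proof.
move=> selP; rewrite -orig_set_neq0 => /(selP k)/andP[_ /subsetP sub].
apply/setP => i; apply/imsetP/idP => [[j]|iS]; first by rewrite inE => ? ->.
have /imsetP[j jS iE] := sub _ iS.
by exists j; rewrite // inE -iE.
Qed.

Lemma choose_JP (V : Type) m n (st : mstate V m n) (sel : selector n) k
    (S : {set 'I_(ncols st)}) : valid_selector sel -> S != set0 ->
  (choose_J sel k S != set0) && (choose_J sel k S \subset S).
Proof.
move=> selP S0; rewrite -orig_set_neq0 orig_set_choose_J //.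
have /(selP k)/andP[-> /subsetP sub] /= : orig_set S != set0.
  by rewrite orig_set_neq0.
apply/subsetP => j; rewrite inE => /sub/imsetP[j' j'S] /enum_val_inj.
by move=> ->.
Qed.

(** * The main loop as a program *)

Definition prescale zero two tau m n (st : mstate nat m n)
    (J : {set 'I_(ncols st)}) : prog (mstate nat m n) :=
  let J' := orig_set J in
  let* d1 := pcol (fun i =>
    if i \in J' then op Div (ms_d st i 0) two else Ret (ms_d st i 0)) in
  let* H := ptest (fun i => leq_test (d1 i 0) tau) in
  let* B := pmatrix (fun i j =>
    if j \in J' then op Div (ms_B st i j) two else Ret (ms_B st i j)) in
  Ret (MState (\col_i (if i \in H then zero else d1 i 0)) B H).

(** The postcondition mentions [map_mstate _ st] rather than [S] because J is typed over [ncols st],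
    which is convertible with the column count of the former. *)
Lemma computes_prescale (R : realType) zero two tau (t : R) m n
    (st : mstate nat m n) (J : {set 'I_(ncols st)}) (S : mstate R m n) mu :
  always (holds 0 zero) mu -> always (holds 2 two) mu ->
  always (holds t tau) mu ->
  always (fun nu => map_mstate (nth 0 nu) st = S) mu ->
  computes mu (prescale zero two tau J) (n + n + m * n)
    (fun st' nu => map_mstate (nth 0 nu) st' =
       @rescale R t m n (map_mstate (nth 0 nu) st) J).
Proof.
move=> H0 H2 Ht HS.
pose D := ms_d S; pose B := ms_B S.
have HD : always (holds_mx D (ms_d st)) mu.
  by move=> nu mn; rewrite /D -(HS _ mn).
have HB : always (holds_mx B (ms_B st)) mu.
  by move=> nu mn; rewrite /B -(HS _ mn).
move: D B HD HB => D B HD HB.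
set J' := orig_set J.
pose D1 : 'cV_n := \col_i (if i \in J' then D i 0 / 2 else D i 0).
apply: (@computes_leq_time _ _ _ _ (n * 1 + (n * 1 + (m * n * 1 + 0)))%N).
  by lia.
apply: computes_bind.
  apply: (computes_pcol (U := D1)) => i nu mn; lift mn.
  have HDi := holds_entry i 0 HD.
  rewrite mxE; case: ifP => _; last exact: computes_ret.
  exact: (computes_op Div HDi H2).
move=> nu d1 mn Hd1; lift mn.
apply: computes_bind.
  apply: (computes_ptest (P := fun i => D1 i 0 <= t)) => i xi mn; lift mn.
  exact: (computes_leq (holds_entry i 0 Hd1) Ht).
move=> {}mu H mn /always_const ->; lift mn.
apply: computes_bind.
  apply: (computes_pmatrix
    (M := \matrix_(i, j) (if j \in J' then B i j / 2 else B i j))) => i j xi mn.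
  lift mn; have HBi := holds_entry i j HB.
  rewrite mxE; case: ifP => _; last exact: computes_ret.
  exact: (computes_op Div HBi H2).
move=> {}nu b mn Hb; lift mn.
apply: computes_ret => xi mn.
have dE : map_mx (nth 0 xi) (ms_d st) = D := HD _ mn.
have BE : map_mx (nth 0 xi) (ms_B st) = B := HB _ mn.
rewrite /rescale /map_mstate /= dE BE; congr MState; last first.
- exact: (Hb _ mn).
- apply/colP => i; rewrite !mxE inE mxE.
  case: ifP => _; first exact: H0.
  by have := Hd1 _ mn; rewrite /holds_mx => /colP/(_ i); rewrite !mxE.
Qed.

Lemma rescale_map_mstate (R : realType) (t : R) m n (st : mstate nat m n)
    (J : {set 'I_(ncols st)}) (f g : nat -> R) :
  map_mstate f st = map_mstate g st ->
  @rescale R t m n (map_mstate f st) J = @rescale R t m n (map_mstate g st) J.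
Proof. by case=> dE BE; rewrite /rescale /= dE BE. Qed.

Definition poutput zero m n (st : mstate nat m n) (z : 'cV[nat]_(ncols st)) :
    prog 'cV[nat]_n :=
  pcol (fun i => if [pick j | orig j == i] is Some j
                 then op Mul (ms_d st i 0) (z j 0) else Ret zero).

Lemma computes_poutput (R : realType) zero m n (st : mstate nat m n)
    (D : 'cV[R]_n) (z : 'cV[nat]_(ncols st)) Z mu :
  always (holds 0 zero) mu -> always (holds_mx D (ms_d st)) mu ->
  always (holds_mx Z z) mu ->
  computes mu (poutput zero z) n (fun x nu => map_mx (nth 0 nu) x =
    @output_vec R m n (map_mstate (nth 0 nu) st) (map_mx (nth 0 nu) z)).
Proof.
move=> H0 HD HZ.
pose X : 'cV_n :=
  \col_i (if [pick j : 'I_(ncols st) | orig j == i] is Some j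
          then D i 0 * Z j 0 else 0).
apply: (computes_weaken (T := n * 1) (P := holds_mx X)); first by rewrite muln1.
  move=> x nu mn; rewrite /holds_mx => ->.
  have DE : map_mx (nth 0 nu) (ms_d st) = D := HD _ mn.
  have ZE : map_mx (nth 0 nu) z = Z := HZ _ mn.
  by rewrite /output_vec /= DE ZE.
apply: computes_pcol => i nu mn; lift mn; rewrite mxE.
case: pickP => [j _|_]; last exact: computes_ret.
exact: (computes_op Mul (holds_entry i 0 HD) (holds_entry j 0 HZ)).
Qed.

Fixpoint pmain zero one cc two half tau C m n (sel : selector n) (fuel k : nat)
    (st : mstate nat m n) :
    prog (seq (round nat m n) * option 'cV[nat]_n) :=
  if fuel is f.+1 then
    let* res := pround zero one cc two half C (ncols st == n)
                  (choose_J sel k) (current st) in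
    match res.2.2 with
    | Case1 =>
        let* x := poutput zero (it_z res.2.1.2) in
        Ret ([:: @Round nat m n st res.1 res.2.1.1 res.2.1.2 (Case1 _)], Some x)
    | Case2 =>
        Ret ([:: @Round nat m n st res.1 res.2.1.1 res.2.1.2 (Case2 _)], None)
    | Case0 J =>
        let* st' := prescale zero two tau J in
        let* rest := pmain zero one cc two half tau C sel f k.+1 st' in
        Ret (@Round nat m n st res.1 res.2.1.1 res.2.1.2 (Case0 J) :: rest.1,
             rest.2)
    end
  else Ret ([::], None).

(** It allows every pass to be charged as if no column had been deleted. *)
Lemma round_cost_leq C m r r' : (r <= r')%N ->
  (round_cost C m r <= round_cost C m r')%N.
Proof.
move=> rr; rewrite /round_cost /basic_cost.
by repeat (apply: leq_add || apply: leq_mul || rewrite leq_exp2r || done).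
Qed.

Section PMain.
Variables (R : realType) (c : R) (zero one cc two half tau C L m n : nat).
Variable sel : selector n.
Hypotheses (c_gt0 : 0 < c) (c_lt2 : c < 2).
Hypothesis C_large : 4 <= C%:R * (c * (2 - c)).
Hypothesis selP : valid_selector sel.

Definition pass_cost := (round_cost C m n + (n + n + m * n))%N.

Lemma computes_pmain fuel k (st : mstate nat m n) (S : mstate R m n) p mu :
  always (holds 0 zero) mu -> always (holds 1 one) mu ->
  always (holds c cc) mu -> always (holds 2 two) mu ->
  always (holds (1 / 2) half) mu -> always (holds (2 ^- L) tau) mu ->
  always (fun nu => map_mstate (nth 0 nu) st = S) mu ->
  halvings_left L (ms_d S) (ms_H S) p -> (p < fuel)%N ->
  computes mu (pmain zero one cc two half tau C sel fuel k st)
    (fuel * pass_cost)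
    (fun res nu => main_run c (2 ^- L) sel k (map_mstate (nth 0 nu) st)
       (map (@map_round _ _ (nth 0 nu) m n) res.1)
       (omap (map_mx (nth 0 nu)) res.2)).
Proof.
elim: fuel k st S p mu => // fuel IH k st S p mu.
move=> H0 H1 Hc H2 Hh Ht HS halv pfuel /=.
apply: (@computes_leq_time _ _ _ _
  (round_cost C m (ncols st) + ((n + n + m * n) + fuel * pass_cost))).
  have : (round_cost C m (ncols st) <= round_cost C m n)%N.
    by apply: round_cost_leq; rewrite -[X in (_ <= X)%N]card_ord max_card.
  by rewrite [(fuel.+1 * _)%N]mulSn {2}/pass_cost; lia.
pose A := colsub (@orig nat m n st) (map_mx (nth 0 mu) (ms_B st)).
have HA : always (holds_mx A (current st)) mu.
  move=> nu mn; have := HS _ mn; rewrite -(HS _ (prefix_refl _)) => -[_ BE].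
  by rewrite /holds_mx map_mxsub BE.
have currentE : always (fun nu =>
    @current R m n (map_mstate (nth 0 nu) st) = A) mu.
  by move=> nu mn; rewrite -(HA _ mn) map_mxsub.
clearbody A.
have chP := choose_JP k selP (st := st).
apply: computes_bind.
  exact: (computes_pround _ c_gt0 c_lt2 C_large chP H0 H1 Hc H2 Hh HA).
move=> nu [Q [[its ret] [||J]]] mn Hres; lift mn => /=.
- apply: (@computes_leq_time _ _ _ _ (n + 0)); first by lia.
  have HD : always (holds_mx (ms_d S) (ms_d st)) nu.
    by move=> xi mn; rewrite -(HS _ mn).
  have HZ : always (holds_mx (map_mx (nth 0 nu) (it_z ret)) (it_z ret)) nu.
    have [_ _ _ Hst] := Hres _ (prefix_refl _).
    by move=> xi mn; have := Hst _ mn => -[_ _ zE].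
  apply: computes_bind; first exact: (computes_poutput H0 HD HZ).
  move=> {}mu x mn Hx; lift mn; apply: computes_ret => xi mn.
  have [isQ Hrun _ _] := Hres _ mn.
  rewrite /= (Hx _ mn); apply: MainPrimal => //.
  by rewrite (currentE _ mn).
- apply: computes_ret => xi mn; have [isQ Hrun _ _] := Hres _ mn.
  by apply: MainDual => //; rewrite (currentE _ mn).
- have [_ _ HJ _] := Hres _ (prefix_refl _).
  have [/= S0 JE] := HJ _ erefl.
  have /andP[J0 _] := chP _ S0; rewrite -JE in J0.
  pose S' : mstate R m n :=
    @rescale R (2 ^- L) m n (map_mstate (nth 0 nu) st) J.
  have [p0 halv'] : (0 < p)%N /\ halvings_left L (ms_d S') (ms_H S') p.-1.
    apply: (@halvings_left_rescale R m n L (map_mstate (nth 0 nu) st) J p J0).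
    by rewrite (HS _ (prefix_refl _)).
  have resE : always (fun xi =>
      @rescale R (2 ^- L) m n (map_mstate (nth 0 xi) st) J = S') nu.
    move=> xi mn; apply: rescale_map_mstate.
    by rewrite (HS _ mn) (HS _ (prefix_refl _)).
  apply: computes_bind; first exact: (computes_prescale J H0 H2 Ht HS).
  clearbody S'; move: J0 => {HJ S0 JE} _ {}mu st' mn Hst'; lift mn.
  have HS' : always (fun xi => map_mstate (nth 0 xi) st' = S') mu.
    by move=> xi mn; rewrite (Hst' _ mn) resE.
  rewrite -[(fuel * _)%N]addn0; apply: computes_bind.
    by apply: IH HS' halv' _ => //; lia.
  move=> {}nu rest mn Hrest; lift mn; apply: computes_ret => xi mn.
  have [isQ Hrun HJ' _] := Hres _ mn.
  have [/= S0 JE] := HJ' _ erefl.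
  rewrite /=; apply: (@MainRescale R c (2 ^- L) m n sel k
    (map_mstate (nth 0 xi) st) _ _ _ J) => //; first by rewrite (currentE _ mn).
  - by rewrite JE; exact: (orig_set_choose_J k selP S0).
  - by have := Hrest _ mn; rewrite (Hst' _ mn).
Qed.
End PMain.

Fixpoint phalve two L x : prog nat :=
  if L is l.+1 then let* a := op Div x two in phalve two l a else Ret x.

Lemma computes_phalve (R : realType) two L x (a : R) mu :
  always (holds 2 two) mu -> always (holds a x) mu ->
  computes mu (phalve two L x) L (holds (a / 2 ^+ L)).
Proof.
elim: L a x mu => [|L IH] a x mu H2 Hx /=.
  by apply: computes_ret; rewrite divr1.
rewrite -add1n; apply: computes_bind; first exact: (computes_op Div Hx H2).
move=> nu y mn Hy; lift mn.
by rewrite exprS invfM mulrA; exact: IH.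
Qed.

Lemma nth_allpairs (S T U : Type) (f : S -> T -> U) (s : seq S) (t : seq T)
    x0 y0 z0 i j : (i < size s)%N -> (j < size t)%N ->
  nth z0 [seq f x y | x <- s, y <- t] (i * size t + j) =
  f (nth x0 s i) (nth y0 t j).
Proof.
elim: s i => // x s IH [|i] /= si tj; rewrite nth_cat size_map.
  by rewrite tj (nth_map y0).
by rewrite mulSn -addnA ltnNge leq_addr /= addKn IH.
Qed.

(* Cells 0 and 1 of the input hold 1 and c. *)
Definition input_state m n : mstate nat m n :=
  MState (const_mx 0%N) (\matrix_(i, j) (i * n + j).+2) set0.

Lemma input_stateE (R : realType) (c : R) m n (A : 'M[R]_(m, n)) :
  always (fun nu => map_mstate (nth 0 nu) (input_state m n) = init_state A)
    (input c A).
Proof.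
move=> nu /prefixP[s ->]; congr MState; apply/matrixP => i j; rewrite !mxE //.
have szj : (j < size (enum 'I_n))%N by rewrite -cardE card_ord.
have szi : (i < size (enum 'I_m))%N by rewrite -cardE card_ord.
have szn : size (enum 'I_n) = n by rewrite -cardE card_ord.
rewrite /input /= nth_cat size_allpairs -!cardE !card_ord.
have -> : (i * n + j < m * n)%N.
  apply: (@leq_trans (i.+1 * n)); first by rewrite mulSnr ltn_add2l.
  by rewrite leq_mul2r ltn_ord orbT.
by rewrite -[X in (i * X + j)%N]szn (nth_allpairs _ i j) ?nth_ord_enum.
Qed.

Definition algorithm C m n L (sel : selector n) : prog (trace nat m n) :=
  let* zero := op Defs.Sub 0 0 in
  let* two := op Add 0 0 in
  let* half := op Div 0 two in
  let* tau := phalve two L 0 in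
  let* res :=
    pmain zero 0 1 two half tau C sel (n * L).+1 0 (input_state m n) in
  Ret (Trace res.1 res.2).

Lemma has_bit_size_gt0 (R : realType) m n (A : 'M[R]_(m, n)) L :
  (0 < m)%N -> (0 < n)%N -> has_bit_size A L -> (0 < L)%N.
Proof.
move=> m0 n0 [A0 _|A0 _].
  by rewrite (bigD1 (Ordinal m0)) //= (bigD1 (Ordinal n0)).
by rewrite (bigD1 (Ordinal m0)) //= (bigD1 (Ordinal n0)).
Qed.

Lemma pass_cost_le C m n : (0 < m)%N -> (m <= n)%N ->
  (pass_cost C m n <= (64 + 25 * C) * (n ^ 3 * m))%N.
Proof.
move=> m0 mn; rewrite /pass_cost /round_cost /basic_cost.
have n0 : (0 < n)%N by exact: leq_trans mn.
have -> : (n ^ 3 = n * n * n)%N by rewrite !expnS expn0 muln1 mulnA.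
have -> : (n ^ 2 = n * n)%N by rewrite !expnS expn0 muln1.
set X := (n * n * n * m)%N.
have nm : (n <= n * m)%N by rewrite leq_pmulr.
have nnm : (n * m <= n * n * m)%N by rewrite leq_mul2r leq_pmulr ?orbT.
have nnnm : (n * n * m <= X)%N by rewrite /X !leq_mul2r leq_pmull ?orbT.
have nn : (n * n <= n * n * m)%N by rewrite leq_pmulr.
have nnn : (n * n * n <= X)%N by rewrite /X leq_pmulr.
have mmn : (m * m * n <= n * n * m)%N.
  by rewrite -mulnA mulnC leq_mul2r mulnC leq_mul2l mn orbT orbT.
have mm : (m * m <= m * m * n)%N by rewrite leq_pmulr.
have CX : (C * (n * n) * m <= C * X)%N by rewrite -mulnA leq_mul2l nnnm orbT.
have Cn : (C * (n * n * n) <= C * X)%N by rewrite leq_mul2l nnn orbT.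
have Cnn : (C * (n * n) <= C * X)%N.
  by rewrite leq_mul2l (leq_trans nn nnnm) orbT.
lia.
Qed.

Theorem theorem1 (R : realType) (c : R) (c_gt0 : 0 < c) (c_lt2 : c < 2) :
  exists (P : forall m n : nat, nat -> selector n -> prog (trace nat m n))
         (C : nat),
  forall (m n : nat) (A : 'M[R]_(m, n)) (L : nat),
    (0 < m)%N -> \rank A = m -> has_bit_size A L ->
  forall sel : selector n, valid_selector sel ->
    carries_out c L sel A (P m n L sel) (C * (n ^ 4 * m * L))%N.
Proof.
have cpos : 0 < c * (2 - c) by rewrite mulr_gt0 // subr_gt0.
pose K := Num.bound (4 / (c * (2 - c))).
have K_large : 4 <= K%:R * (c * (2 - c)).
  rewrite -ler_pdivrMr // ltW // archi_boundP //.
  by rewrite divr_ge0 // ltW.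
exists (@algorithm K), (132 + 50 * K)%N => m n A L m0 rkA bitA sel selP.
have mn : (m <= n)%N by rewrite -rkA rank_leq_col.
have n0 : (0 < n)%N by exact: leq_trans mn.
have L0 : (0 < L)%N by exact: has_bit_size_gt0 bitA.
have H1 : always (holds 1 0) (input c A) by move=> nu /prefixP[s ->].
have Hc : always (holds c 1) (input c A) by move=> nu /prefixP[s ->].
have HA := @input_stateE R c m n A.
suff : computes (input c A) (@algorithm K m n L sel)
    (1 + (1 + (1 + (L + ((n * L).+1 * pass_cost K m n + 0)))))%N
    (fun tr mu => main_algorithm c L sel A
       (@map_trace _ _ (nth 0 mu) m n tr)).
  rewrite /carries_out /computes; case: exec => [[mu tr] t] [_ tT Hrun].
  split; first exact: Hrun (prefix_refl _).
  apply: leq_trans tT _.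
  have := pass_cost_le K m0 mn; set pc := pass_cost _ _ _ => pc_le.
  apply: (@leq_trans (4 * L + 2 * (n * L) * pc)).
    have : ((n * L).+1 * pc <= 2 * (n * L) * pc)%N.
      by rewrite leq_mul2r; apply/orP; right; have := muln_gt0 n L; lia.
    by lia.
  have -> : (n ^ 4 * m * L = n ^ 3 * m * (n * L))%N.
    by rewrite expnSr; ring.
  have X1 : (1 <= n ^ 3 * m * n)%N by rewrite !muln_gt0 ?expn_gt0 n0 m0.
  have XL : (L <= n ^ 3 * m * (n * L))%N by rewrite mulnA leq_pmull.
  have := leq_mul (leqnn (2 * (n * L))) pc_le.
  by lia.
rewrite /algorithm; apply: computes_bind.
  exact: (computes_op Defs.Sub H1 H1).
move=> nu zero mn0 H0; rewrite /= subrr in H0; lift mn0.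
apply: computes_bind; first exact: (computes_op Add H1 H1).
move=> mu two mn0 H2; rewrite /= in H2; lift mn0.
apply: computes_bind; first exact: (computes_op Div H1 H2).
move=> {}nu half mn0 Hh; rewrite /= in Hh; lift mn0.
apply: computes_bind; first exact: (computes_phalve _ H2 H1).
move=> {}mu tau mn0 Ht; rewrite mul1r in Ht; lift mn0.
apply: computes_bind.
  apply: (computes_pmain c_gt0 c_lt2 K_large selP 0 H0 H1 Hc H2 Hh Ht HA).
    exact: halvings_left_init L0.
  exact: ltnSn.
move=> {}nu res mn0 Hres; lift mn0; apply: computes_ret => xi nx.
by have := Hres _ nx; rewrite (HA _ nx).
Qed.
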